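(* Let $s_1,s_2\in(0,1)$, let $f_1\in L^2(\Omega_1)$, and let $f_2\in L^2(\Omega_2)$. Then there exists a unique minimizer $u$ in $H$ of the functional $\mathcal{E}:H\to\mathbb{R}$, $$\mathcal{E}(u)=E(u)-\int_{\Omega_1}f_1u_1\,\mathrm{d}x-\int_{\Omega_2}f_2u_2\,\mathrm{d}x .$$
   Context: Setting. Let $n\ge 2$ and let $\Omega_1,\Omega_2\subset\mathbb{R}^n$ be open, connected, bounded domains with Lipschitz boundaries and $\overline{\Omega}_1\cap\overline{\Omega}_2=\emptyset$; $d:=\mathrm{dist}(\Omega_1,\Omega_2)>0$. $\Omega^c$ denotes the complement of $\Omega$ in $\mathbb{R}^n$. The kernel $J:\mathbb{R}^n\to\mathbb{R}$ is measurable and satisfies: $J(z)\ge 0$ and $J(z)=J(-z)$ for a.e. $z$; $J\in L^1(\mathbb{R}^n)$; there exists $r>d$ such that $B_r(0)\subset\mathrm{supp}(J)$. For $i\in\{1,2\}$, $\mathcal{C}_i=c(n,s_i)/2$, where $c(n,s_i)>0$ is the normalization constant of the fractional Laplacian $(-\Delta)^{s_i}$ on $\mathbb{R}^n$. Spaces. For $s\in(0,1)$, $\tilde H^s(\Omega)$ is the closure of $C_0^\infty(\Omega)$ in $H^s(\mathbb{R}^n)$ (equivalently, functions of $H^s(\mathbb{R}^n)$ supported in $\overline\Omega$), with norm $|v|_{\tilde H^s(\Omega)}^2=\int_{\mathbb{R}^n}\int_{\mathbb{R}^n}\frac{|v(x)-v(y)|^2}{|x-y|^{n+2s}}\,\mathrm{d}x\,\mathrm{d}y$;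 its elements vanish outside $\Omega$. $H:=\tilde H^{s_1}(\Omega_1)\oplus\tilde H^{s_2}(\Omega_2)=\{u=u_1+u_2:u_i\in\tilde H^{s_i}(\Omega_i)\}$, with norm $|u|_H=(|u_1|^2_{\tilde H^{s_1}(\Omega_1)}+|u_2|^2_{\tilde H^{s_2}(\Omega_2)})^{1/2}$. Energy. For $u=u_1+u_2\in H$, $$E(u)=\frac{\mathcal{C}_1}{2}\int_{\Omega_2^c}\int_{\Omega_2^c}\frac{(u_1(x)-u_1(y))^2}{|x-y|^{n+2s_1}}\,\mathrm{d}y\,\mathrm{d}x+\frac{\mathcal{C}_2}{2}\int_{\Omega_1^c}\int_{\Omega_1^c}\frac{(u_2(x)-u_2(y))^2}{|x-y|^{n+2s_2}}\,\mathrm{d}y\,\mathrm{d}x+\frac12\int_{\Omega_1}\int_{\Omega_2}J(x-y)(u_1(x)-u_2(y))^2\,\mathrm{d}y\,\mathrm{d}x .$$ *)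

(* Defs.v *)
From HB Require Import structures.
From mathcomp Require Import all_boot all_order all_algebra.
From mathcomp Require Import all_classical all_reals all_analysis.

Set Implicit Arguments.
Unset Strict Implicit.
Unset Printing Implicit Defensive.

Import Order.TTheory GRing.Theory Num.Theory.
Import numFieldNormedType.Exports.

Local Open Scope classical_set_scope.
Local Open Scope ring_scope.

(* The sigma-algebra generated by the coordinate maps, i.e. the Borel
   sigma-algebra of R^n. *)
Fact rV_display : measure_display.
Proof. exact: default_measure_display. Qed.

Section rV_measurable.
Variables (R : realType) (n : nat).

Let coord (i : 'I_n) (x : 'rV[R]_n) : R := x ord0 i.

Let rV_set0 : g_sigma_preimage coord set0.
Proof. exact: sigma_algebra0. Qed.

Let rV_setC A : g_sigma_preimage coord A -> g_sigma_preimage coord (~` A).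
Proof. exact: sigma_algebraC. Qed.

Let rV_bigcup (F : _^nat) : (forall i, g_sigma_preimage coord (F i)) ->
  g_sigma_preimage coord (\bigcup_i (F i)).
Proof. exact: sigma_algebra_bigcup. Qed.

HB.instance Definition _ := @isMeasurable.Build rV_display 'rV[R]_n
  (g_sigma_preimage coord) rV_set0 rV_setC rV_bigcup.

End rV_measurable.

Lemma measurable_coord (R : realType) (n : nat) (i : 'I_n) :
  measurable_fun setT (fun x : 'rV[R]_n => x ord0 i).
Proof.
move=> _ Y mY; rewrite setTI; apply: sub_sigma_algebra => /=.
by rewrite (bigD1 i)//=; left; exists Y => //; rewrite setTI.
Qed.

Lemma measurable_fun_rV d (T : measurableType d) (R : realType) (n : nat)
    (f : T -> 'rV[R]_n) :
  (forall i, measurable_fun setT (fun t => f t ord0 i)) ->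
  measurable_fun setT f.
Proof.
move=> mf; apply: (@measurability _ _ _ _ _ _
  (\big[setU/set0]_(i < n)
     preimage_set_system setT (fun x : 'rV[R]_n => x ord0 i) measurable)) => //.
move=> _ [B + <-].
elim/big_ind : _ => //.
- by move=> P Q hP hQ [/hP|/hQ].
- move=> i _ [Y mY <-]; rewrite !setTI.
  by have := mf i measurableT Y mY; rewrite setTI.
Qed.

Section lebesgue_rV.
Variable R : realType.

Definition rV_cons (n : nat) (p : 'rV[R]_n * R) : 'rV[R]_n.+1 :=
  \row_i oapp (p.1 ord0) p.2 (unlift ord0 i).

Lemma measurable_rV_cons n : measurable_fun setT (@rV_cons n).
Proof.
apply: measurable_fun_rV => i; rewrite /rV_cons.
under eq_fun do rewrite mxE.
case: unliftP => [j _|_] /=; last exact: measurable_snd.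
apply: (@measurableT_comp _ _ _ _ _ _ (fun x : 'rV[R]_n => x ord0 j)).
  exact: measurable_coord.
exact: measurable_fst.
Qed.

Definition rV_prod n (m : {measure set 'rV[R]_n -> \bar R}) :
    set 'rV[R]_n.+1 -> \bar R :=
  pushforward (m \x lebesgue_measure)%E (@rV_cons n).

HB.instance Definition _ n (m : {measure set 'rV[R]_n -> \bar R}) :=
  Measure.copy (rV_prod m)
  (measure_function_pushforward__canonical__measure_function_Measure
    (m \x lebesgue_measure)%E (@measurable_rV_cons n)).

Fixpoint lebesgue_rV (n : nat) : {measure set 'rV[R]_n -> \bar R} :=
  match n with
  | 0%N => \d_(0 : 'rV[R]_0)
  | m.+1 => rV_prod (lebesgue_rV m)
  end.

Lemma lebesgue_rV_box n (A : 'I_n -> set R) :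
  (forall i, measurable (A i)) ->
  lebesgue_rV n [set x | forall i, A i (x ord0 i)] =
  (\prod_(i < n) lebesgue_measure (A i))%E.
Proof.
elim: n A => [|n ih] A mA /=.
  rewrite big_ord0 diracE mem_set//; by case.
pose B := [set x : 'rV[R]_n | forall i, A (lift ord0 i) (x ord0 i)].
have mB : measurable B.
  rewrite (_ : B = \bigcap_(i in [set: 'I_n])
      ((fun x : 'rV[R]_n => x ord0 i) @^-1` A (lift ord0 i))); last first.
    by apply/seteqP; split => x /= h i; [move=> _|]; exact: h.
  apply: fin_bigcap_measurable => // i _; rewrite -[X in measurable X]setTI.
  exact: measurable_coord.
rewrite big_ord_recl muleC -ih// -(product_measure1E _ _ mB)//.
  rewrite /rV_prod /pushforward; congr (_ _).
  apply/seteqP; split => -[x t] /=.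
    move=> h; split=> [i|].
      by have := h (lift ord0 i); rewrite mxE liftK.
    by have := h ord0; rewrite mxE unlift_none.
  by move=> [h1 h2] i; rewrite mxE; case: unliftP => [j ->|->]/=.
exact: (mA ord0).
Qed.

End lebesgue_rV.

(* The norm that the library puts on 'rV[R]_n is the sup norm; it gives the
   usual topology, but distances and balls of R^n need the Euclidean norm. *)
Definition enorm (R : realType) n (x : 'rV[R]_n) : R :=
  Num.sqrt (\sum_(i < n) x ord0 i ^+ 2).

Definition eball (R : realType) n (p : 'rV[R]_n) (r : R) : set 'rV[R]_n :=
  [set x | enorm (x - p) < r].

Definition set_dist (R : realType) n (A B : set 'rV[R]_n) : R :=
  inf [set enorm (x - y) | x in A & y in B].

(* After an orthogonal change of coordinates Q, O is near each boundary point
   the part above the graph of a Lipschitz function g; "col' k" deletes the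
   k-th coordinate. *)
Definition lipschitz_boundary (R : realType) n (O : set 'rV[R]_n) : Prop :=
  forall p, (closure O `\` interior O) p ->
  exists (Q : 'M[R]_n) (k : 'I_n) (g : 'rV[R]_n.-1 -> R) (L r : R),
    [/\ Q *m Q^T = 1%:M, 0 < r,
        forall a b, `|g a - g b| <= L * enorm (a - b) &
        O `&` eball p r =
        [set x | g (col' k (x *m Q)) < (x *m Q) ord0 k] `&` eball p r].

Definition lipschitz_domain (R : realType) n (O : set 'rV[R]_n) : Prop :=
  [/\ O !=set0, open O, connected O, bounded_set O & lipschitz_boundary O].

Definition partials (R : realType) n (l : seq 'I_n) (f : 'rV[R]_n -> R) :
    'rV[R]_n -> R :=
  foldr (fun i h => fun x => 'D_(delta_mx ord0 i) h x) f l.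

Definition smooth (R : realType) n (f : 'rV[R]_n -> R) : Prop :=
  forall l : seq 'I_n, continuous (partials l f) /\
    forall i x, derivable (partials l f) x (delta_mx ord0 i).

Definition test_function (R : realType) n (O : set 'rV[R]_n)
    (f : 'rV[R]_n -> R) : Prop :=
  [/\ smooth f, compact (closure [set x | f x != 0]) &
      closure [set x | f x != 0] `<=` O].

Section function_spaces.
Variables (R : realType) (n : nat).
Local Notation mu := (lebesgue_rV R n).
Implicit Types (O : set 'rV[R]_n) (s : R) (f v : 'rV[R]_n -> R).
Local Open Scope ereal_scope.

Definition L2_on O f : Prop :=
  measurable_fun O f /\ \int[mu]_(x in O) (f x ^+ 2)%:E < +oo.

Definition gagliardo_on O s v : \bar R :=
  \int[mu]_(x in O) \int[mu]_(y in O)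
    ((v x - v y) ^+ 2 / enorm (x - y) `^ (n%:R + 2 * s))%:E.

Definition Hs s : set ('rV[R]_n -> R) :=
  [set v | L2_on setT v /\ gagliardo_on setT s v < +oo].

Definition Hs_norm_sqr s v : \bar R :=
  \int[mu]_x (v x ^+ 2)%:E + gagliardo_on setT s v.

(* Closure of the test functions on O in Hs s, for the H^s norm. *)
Definition Htilde O s : set ('rV[R]_n -> R) :=
  [set v | Hs s v /\ forall e : R, (0 < e)%R ->
     exists2 phi, test_function O phi & Hs_norm_sqr s (v \- phi)%R < (e ^+ 2)%:E].

(* Essential support: the complement of the largest open set on which f
   vanishes almost everywhere. *)
Definition ess_support f : set 'rV[R]_n :=
  [set x | forall U, open U -> U x -> ~ {ae mu, forall z, U z -> f z = 0%R}].

End function_spaces.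

Definition Gamma (R : realType) (a : R) : R :=
  fine (\int[lebesgue_measure]_(t in `]0%R, +oo[)
          (t `^ (a - 1) * expR (- t))%:E)%E.

(* The constant for which (-Delta)^s has Fourier symbol |xi|^(2s). *)
Definition frac_laplacian_const (R : realType) (n : nat) (s : R) : R :=
  2 `^ (2 * s) * s * Gamma (s + n%:R / 2) /
  (pi `^ (n%:R / 2) * Gamma (1 - s)).

Definition frac_coef (R : realType) (n : nat) (s : R) : R :=
  frac_laplacian_const n s / 2.

Section energy.
Variables (R : realType) (n : nat).
Local Notation mu := (lebesgue_rV R n).
Variables (O1 O2 : set 'rV[R]_n) (J : 'rV[R]_n -> R) (s1 s2 : R).
Variables (f1 f2 : 'rV[R]_n -> R).
Local Open Scope ereal_scope.

Definition energy (u1 u2 : 'rV[R]_n -> R) : \bar R :=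
  (frac_coef n s1 / 2)%:E * gagliardo_on (~` O2) s1 u1 +
  (frac_coef n s2 / 2)%:E * gagliardo_on (~` O1) s2 u2 +
  (2^-1)%:E * \int[mu]_(x in O1) \int[mu]_(y in O2)
    (J (x - y) * (u1 x - u2 y) ^+ 2)%:E.

Definition total_energy (u1 u2 : 'rV[R]_n -> R) : \bar R :=
  energy u1 u2 - \int[mu]_(x in O1) (f1 x * u1 x)%:E
               - \int[mu]_(x in O2) (f2 x * u2 x)%:E.

(* u = u1 + u2 with u1, u2 in the two summands of H; u belongs to H when it
   has such a decomposition, which is unique up to null sets. *)
Definition H_decomposition (u u1 u2 : 'rV[R]_n -> R) : Prop :=
  [/\ Htilde O1 s1 u1, Htilde O2 s2 u2 & u = (u1 \+ u2)%R].

Definition H_minimizer (u : 'rV[R]_n -> R) : Prop :=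
  exists u1 u2, H_decomposition u u1 u2 /\
    forall w w1 w2, H_decomposition w w1 w2 ->
      total_energy u1 u2 <= total_energy w1 w2.

End energy.

(* Main.v *)
Require Import Defs.
From HB Require Import structures.
From mathcomp Require Import all_boot all_order all_algebra.
From mathcomp Require Import all_classical all_reals all_analysis.
From mathcomp Require Import measurable_realfun.
From mathcomp Require Import ring lra zify.

Set Implicit Arguments.
Unset Strict Implicit.
Unset Printing Implicit Defensive.
Import Order.TTheory GRing.Theory Num.Theory.
Import numFieldNormedType.Exports.

Local Open Scope classical_set_scope.
Local Open Scope ring_scope.

(** Why a unique minimizer exists.  On pairs (u1, u2) of functions in the two
summands of H, the energy A is a nonnegative quadratic form and the source
term l is linear, so for F = A - l the parallelogram identity reads
  A ((u - v) / 2) = (F u + F v) / 2 - F ((u + v) / 2).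
Two minimizers u and v therefore satisfy A (u - v) = 0, and every minimizing
sequence is Cauchy for A.  If F is bounded below and A-Cauchy sequences have
A-limits in H, the limit is a minimizer.  This part is pure algebra
([minimizer_unique], [minimizer_exists]).

What has to be supplied is that A is equivalent to the squared norm of H^s
on each component, even though its Gagliardo terms ignore all pairs (x, y)
with a point in the other domain:

- Poincare inequality ([poincare_far]).  An element of the first summand
  vanishes almost everywhere outside Omega_1.  Pick a unit cube W away from
  both domains; for x in Omega_1 and y in W the Gagliardo integrand is
  u(x)^2 / |x - y|^(n+2s), and the kernel is bounded below there because
  everything is bounded.  Integrating over W controls the L^2 norm of u.

- Missing interactions ([sobolev_le_censored_L2]).  The pairs (x, y) with x in
  Omega_1 and y in Omega_2 are at distance at least some delta > 0, since the
  closures are disjoint and compact; they contribute at most a multiple of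
  |Omega_2| times the squared L^2 norm, which has just been controlled.

- The coupling term is bounded by a multiple of the L^1 norm of J times the
  squared L^2 norms ([coupling_energy_le]); this uses that Lebesgue measure
  is invariant under y |-> x - y ([ge0_integral_rV_reflect]).

- The constants in front of the Gagliardo terms are positive
  ([frac_coef_gt0]): the Gamma integrals converge, so that they are genuine
  positive reals.

The two inequalities give coercivity, hence a lower bound for F (Young's
inequality absorbs l into A) and uniqueness almost everywhere.  Completeness
of H^s ([sobolev_complete]) is the Riesz-Fischer argument: a rapidly Cauchy
subsequence converges almost everywhere, and Fatou's lemma, applied to the
L^2 norm and to the Gagliardo seminorm, turns this into convergence in norm.
The closure of the test functions inherits completeness ([Htilde_closed]). *)

(** * Minimization of a quadratic functional *)

Lemma exists_natSinv_lt (R : realType) (e : R) : 0 < e ->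
  exists N : nat, N.+1%:R^-1 < e.
Proof.
move=> e0; have := @near_infty_natSinv_lt R (PosNum e0).
by case=> N _ /(_ N) /=; rewrite leqnn => /(_ isT) h; exists N.
Qed.

Definition subspace_set (R : realType) (V : lmodType R) (X : set V) : Prop :=
  X 0 /\ forall (a b : R) u v, X u -> X v -> X (a *: u + b *: v).

Record quadratic_on (R : realType) (V : lmodType R) (X : set V) (A : V -> R)
    : Prop := {
  quad_ge0 : forall u, X u -> 0 <= A u ;
  quadD : forall u v, X u -> X v -> A (u + v) + A (u - v) = 2 * A u + 2 * A v ;
  quadZ : forall a u, X u -> A (a *: u) = a ^+ 2 * A u }.

(** The A-limit is a cluster point: in the minimization argument v is reflected
through points u_k that are both near v and near-optimal, and these need only
occur at arbitrarily large k. *)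
Definition complete_for (R : realType) (V : lmodType R) (X : set V) (A : V -> R)
    : Prop :=
  forall u : nat -> V, (forall k, X (u k)) ->
  (forall e, 0 < e -> exists N, forall j k, (N <= j)%N -> (N <= k)%N ->
     A (u j - u k) <= e) ->
  exists2 v, X v &
  forall e, 0 < e -> forall N, exists2 k, (N <= k)%N & A (u k - v) <= e.

Section quadratic_minimization.
Variables (R : realType) (V : lmodType R) (X : set V) (A l : V -> R).
Hypothesis subX : subspace_set X.
Hypothesis quadA : quadratic_on X A.
Hypothesis linl : forall (a b : R) u v, X u -> X v ->
  l (a *: u + b *: v) = a * l u + b * l v.

Let F u := A u - l u.

Let XD (a b : R) u v : X u -> X v -> X (a *: u + b *: v).
Proof. by case: subX => _; apply. Qed.

Let midpoint u v : X u -> X v ->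
  4^-1 * A (u - v) = 2^-1 * (F u + F v) - F (2^-1 *: u + 2^-1 *: v).
Proof.
move=> Xu Xv; rewrite /F linl//.
have X1 : X (2^-1 *: u) by have := XD 2^-1 0 Xu Xu; rewrite scale0r addr0.
have X2 : X (2^-1 *: v) by have := XD 2^-1 0 Xv Xv; rewrite scale0r addr0.
have Xd : X (u - v) by have := XD 1 (-1) Xu Xv; rewrite scale1r scaleN1r.
have := quadD quadA X1 X2.
rewrite -scalerBr !(quadZ quadA)//.
set a := A (_ + _); set b := A (u - v); lra.
Qed.

(** The midpoint identity leaves no room for A (u - v) > 0. *)
Lemma minimizer_unique u v : X u -> X v ->
  (forall w, X w -> F u <= F w) -> (forall w, X w -> F v <= F w) ->
  A (u - v) = 0.
Proof.
move=> Xu Xv minu minv.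
have Xd : X (u - v) by have := XD 1 (-1) Xu Xv; rewrite scale1r scaleN1r.
have := midpoint Xu Xv.
have := minu _ (XD 2^-1 2^-1 Xu Xv); have := minv _ (XD 2^-1 2^-1 Xu Xv).
have := quad_ge0 quadA Xd.
set a := F _; set b := F _; set c := F _; set d := A _; lra.
Qed.

(** With u_k near-optimal and v a cluster point, the competitor 2 u_k - v gives
F v + F (2 u_k - v) = 2 F u_k + 2 A (u_k - v), so F v exceeds the infimum by
an arbitrarily small amount. *)
Lemma minimizer_exists M : (forall u, X u -> M <= F u) -> complete_for X A ->
  exists2 u, X u & forall w, X w -> F u <= F w.
Proof.
move=> bF cX.
pose m := inf (F @` X).
have infF : has_inf (F @` X).
  split; first by exists (F 0); exists 0 => //; case: subX.
  by exists M => _ [u Xu <-]; exact: bF.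
have mF w : X w -> m <= F w.
  by move=> Xw; apply: ge_inf; [exact: infF.2|exists w].
have near_min k : exists u, X u /\ F u < m + k.+1%:R^-1.
  have k0 : 0 < k.+1%:R^-1 :> R by rewrite invr_gt0.
  by have [_ [u Xu <-] Fu] := inf_adherent k0 infF; exists u.
have [u uP] := choice near_min.
have Xu k : X (u k) by have [] := uP k.
have [|v Xv uv] := cX u Xu.
  move=> e e0; have [N Ne] := exists_natSinv_lt (divr_gt0 e0 (ltr0Sn R 3)).
  exists N => j k Nj Nk.
  have small i : (N <= i)%N -> F (u i) < m + e / 4.
    move=> Ni; have [_ /lt_le_trans] := uP i; apply; rewrite lerD2l.
    apply/ltW; apply: le_lt_trans Ne; rewrite lef_pV2 ?posrE// ler_nat.
    by rewrite ltnS.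
  have := midpoint (Xu j) (Xu k); have := small _ Nj; have := small _ Nk.
  have := mF _ (XD 2^-1 2^-1 (Xu j) (Xu k)).
  set a := F _; set b := F _; set c := F _; set d := A _; lra.
exists v => // w Xw; apply: (le_trans _ (mF _ Xw)).
apply/ler_addgt0Pr => e e0.
have [N Ne] := exists_natSinv_lt (divr_gt0 e0 (ltr0Sn R 3)).
have [k Nk uvk] := uv _ (divr_gt0 e0 (ltr0Sn R 3)) N.
have Fuk : F (u k) < m + e / 4.
  have [_ /lt_le_trans] := uP k; apply; rewrite lerD2l.
  by apply/ltW; apply: le_lt_trans Ne; rewrite lef_pV2 ?posrE// ler_nat ltnS.
(* the reflection of v through u k is a competitor *)
have Xr := XD 2 (-1) (Xu k) Xv.
have := mF _ Xr; have := midpoint Xv Xr.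
have -> : 2^-1 *: v + 2^-1 *: (2 *: u k + (-1) *: v) = u k.
  rewrite scalerDr scaleN1r scalerN scalerA mulVf ?pnatr_eq0// scale1r.
  by rewrite addrCA subrr addr0.
have -> : v - (2 *: u k + (-1) *: v) = (-2) *: (u k - v).
  rewrite scaleN1r scalerBr !scaleNr opprD !opprK addrCA; congr (_ + _).
  by rewrite scaler_nat mulr2n.
have Xd : X (u k - v) by have := XD 1 (-1) (Xu k) Xv; rewrite scale1r scaleN1r.
rewrite (quadZ quadA)//; move: Fuk uvk.
set a := F _; set b := F _; set c := F _; set d := A _; lra.
Qed.

End quadratic_minimization.

(** * Weighted squares and completeness of the Sobolev norm *)

Lemma limn_einf_le (R : realType) (u : (\bar R)^nat) (a : \bar R) N :
  (forall k, (N <= k)%N -> (u k <= a)%E) -> (limn_einf u <= a)%E.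
Proof.
move=> ua; rewrite limn_einf_lim; apply: lime_le; first exact: is_cvg_einfs.
exists N => // k /= Nk; apply: le_trans (ua k Nk).
by apply: ereal_inf_lbound; exists k => //=.
Qed.

Section weighted_square.
Context d (T : measurableType d) (R : realType).
Variable mu : {measure set T -> \bar R}.
Implicit Types (K f g : T -> R).
Local Open Scope ereal_scope.

Definition wsq K g : \bar R := \int[mu]_x (K x * g x ^+ 2)%:E.

Lemma measurable_wsq K g : measurable_fun setT K -> measurable_fun setT g ->
  measurable_fun setT (fun x => (K x * g x ^+ 2)%:E).
Proof.
by move=> mK mg; apply/measurable_EFinP/measurable_funM => //; exact: measurable_funX.
Qed.

Lemma wsq_ge0 K g : (forall x, (0 <= K x)%R) -> 0 <= wsq K g.
Proof.
by move=> K0; apply: integral_ge0 => x _; rewrite lee_fin mulr_ge0 ?sqr_ge0.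
Qed.

Lemma wsq_parallelogram K f g : measurable_fun setT K -> (forall x, (0 <= K x)%R) ->
  measurable_fun setT f -> measurable_fun setT g ->
  wsq K (fun x => f x + g x)%R + wsq K (fun x => f x - g x)%R =
  2%:E * wsq K f + 2%:E * wsq K g.
Proof.
move=> mK K0 mf mg.
have ge0 h x : 0 <= (K x * h x ^+ 2)%:E by rewrite lee_fin mulr_ge0 ?sqr_ge0.
rewrite /wsq -!ge0_integralZl//; try by apply: measurable_wsq.
rewrite -!ge0_integralD//; try (by move=> x _; rewrite ?mule_ge0); last first.
- exact: (measurable_wsq mK (measurable_funB mf mg)).
- by move=> x _; exact: (ge0 (fun x => f x - g x)%R).
- exact: (measurable_wsq mK (measurable_funD mf mg)).
- by move=> x _; exact: (ge0 (fun x => f x + g x)%R).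
- by apply: measurable_funeM; apply: measurable_wsq.
- by apply: measurable_funeM; apply: measurable_wsq.
by apply: eq_integral => x _; rewrite -!EFinM -!EFinD; congr EFin; ring.
Qed.

Lemma wsqZ K a g : measurable_fun setT K -> (forall x, (0 <= K x)%R) ->
  measurable_fun setT g ->
  wsq K (fun x => a * g x)%R = (a ^+ 2)%:E * wsq K g.
Proof.
move=> mK K0 mg; rewrite /wsq -ge0_integralZl//.
- by apply: eq_integral => x _; rewrite -EFinM; congr EFin; ring.
- exact: measurable_wsq.
- by move=> x _; rewrite lee_fin mulr_ge0 ?sqr_ge0.
- by rewrite lee_fin sqr_ge0.
Qed.

Lemma wsqD_le K f g : measurable_fun setT K -> (forall x, (0 <= K x)%R) ->
  measurable_fun setT f -> measurable_fun setT g ->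
  wsq K (fun x => f x + g x)%R <= 2%:E * wsq K f + 2%:E * wsq K g.
Proof.
by move=> mK K0 mf mg; rewrite -wsq_parallelogram// leeDl// wsq_ge0.
Qed.

Lemma wsq_le_ae (c : R) K K' f g :
  measurable_fun setT K -> (forall x, (0 <= K x)%R) ->
  measurable_fun setT K' -> (forall x, (0 <= K' x)%R) ->
  measurable_fun setT f -> measurable_fun setT g -> (0 <= c)%R ->
  {ae mu, forall x, (K x * f x ^+ 2 <= c * (K' x * g x ^+ 2))%R} ->
  wsq K f <= c%:E * wsq K' g.
Proof.
move=> mK K0 mK' K0' mf mg c0 fg.
have ge0 (L h : T -> R) : (forall x, (0 <= L x)%R) -> forall x, 0 <= (L x * h x ^+ 2)%:E.
  move=> L0 x; rewrite lee_fin; apply: mulr_ge0; last exact: sqr_ge0.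
  exact: L0.
rewrite /wsq -ge0_integralZl//.
- apply: ae_ge0_le_integral => //.
  + by move=> x _; exact: ge0.
  + exact: measurable_wsq.
  + by move=> x _; rewrite mule_ge0 ?ge0.
  + by apply: measurable_funeM; exact: measurable_wsq.
  + by apply: filterS fg => x fgx _; rewrite -EFinM lee_fin.
- exact: measurable_wsq.
- by move=> x _; exact: ge0.
Qed.

(** Lower semicontinuity: the only passage to the limit in the proof of
completeness. *)
Lemma wsq_fatou K (g : nat -> T -> R) (h : T -> R) (a : \bar R) (N : nat) :
  measurable_fun setT K -> (forall x, (0 <= K x)%R) ->
  (forall k, measurable_fun setT (g k)) -> measurable_fun setT h ->
  {ae mu, forall x, g ^~ x @ \oo --> h x} ->
  (forall k, (N <= k)%N -> wsq K (g k) <= a) -> wsq K h <= a.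
Proof.
move=> mK K0 mg mh [Z [mZ Z0 gh]] ga.
have ge0 f x : 0 <= (K x * f x ^+ 2)%:E by rewrite lee_fin mulr_ge0 ?sqr_ge0.
have mZC : measurable (~` Z) by exact: measurableC.
rewrite /wsq (ge0_negligible_integral mZ)//; last exact: measurable_wsq.
rewrite setTD.
rewrite (_ : \int[mu]_(x in ~` Z) _ =
   \int[mu]_(x in ~` Z) limn_einf (fun k => (K x * g k x ^+ 2)%:E)); last first.
  apply: eq_integral => x /set_mem /= Zx.
  have gx : g ^~ x @ \oo --> h x by apply: contrapT => /gh.
  suff /cvg_limn_einf_sup[-> _] : (fun k => (K x * g k x ^+ 2)%:E) @ \oo -->
    (K x * h x ^+ 2)%:E by [].
  apply: cvg_EFin; first exact: nearW.
  apply: cvgM; first exact: cvg_cst.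
  exact: (cvgM gx gx).
apply: le_trans.
  apply: fatou => // k; apply: measurable_funTS; exact: measurable_wsq.
apply: (@limn_einf_le _ _ _ N) => k Nk; apply: le_trans (ga k Nk).
by apply: ge0_subset_integral => //; exact: measurable_wsq.
Qed.

End weighted_square.

Section riesz_fischer.
Context d (T : measurableType d) (R : realType).
Variable mu : {measure set T -> \bar R}.

(** Square weights 2^k instead of absolute values avoid Minkowski's inequality:
|d| <= (2^-k + 2^k d^2) / 2. *)
Lemma summable_cvg (w : nat -> R) :
  cvgn (series (fun k => 2 ^+ k * (w k.+1 - w k) ^+ 2)) -> cvgn w.
Proof.
move=> cw.
suff : cvgn [normed series (telescope w)].
  move=> /normed_cvg/cvg_ex[l h].
  apply/cvg_ex; exists (w 0%N + l).
  have wE : w = (fun n => w 0%N + series (telescope w) n).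
    by apply/funext => n; rewrite -eq_sum_telescope.
  by rewrite [X in X @ _ --> _]wE; apply: cvgD h; exact: cvg_cst.
apply: (@series_le_cvg _ _
  (fun k => 2^-1 * (2^-1 ^+ k + 2 ^+ k * (w k.+1 - w k) ^+ 2))) => [k|k|k|].
- exact: normr_ge0.
- apply: mulr_ge0; first by rewrite invr_ge0.
  apply: addr_ge0; first by rewrite exprn_ge0// invr_ge0.
  by apply: mulr_ge0; [exact: exprn_ge0|exact: sqr_ge0].
- (* arithmetic-geometric mean inequality between 2^-k and 2^k d^2 *)
  rewrite /telescope/= -(real_normK (num_real (w k.+1 - w k))).
  have a0 : 0 < 2 ^+ k :> R by rewrite exprn_gt0.
  rewrite exprVn; move: (2 ^+ k) a0 => a a0; set t := `|_|.
  rewrite -subr_ge0 (_ : _ - _ = 2^-1 * a * (a^-1 - t) ^+ 2).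
    by rewrite mulr_ge0 ?sqr_ge0// mulr_ge0// ltW.
  by field; rewrite gt_eqF.
- apply: is_cvg_seriesZ; apply: is_cvg_seriesD => //.
  have := @is_cvg_geometric_series R 1 2^-1.
  rewrite ger0_norm// => /(_ _)/=.
  rewrite (_ : geometric 1 2^-1 = (fun k => 2^-1 ^+ k)); last first.
    by apply/funext => k; rewrite /geometric/= mul1r.
  by apply; rewrite invf_lt1// ltr1n.
Qed.

(** The series of the 2^k (w_{k+1} - w_k)^2 has finite integral, hence is finite
almost everywhere, and where it is finite the sequence converges. *)
Lemma fast_cauchy_ae_cvg (w : nat -> T -> R) :
  (forall k, measurable_fun setT (w k)) ->
  (forall k, \int[mu]_x ((w k.+1 x - w k x) ^+ 2)%:E <= (8^-1 ^+ k)%:E)%E ->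
  exists2 v : T -> R, measurable_fun setT v &
    {ae mu, forall x, w ^~ x @ \oo --> v x}.
Proof.
move=> mw w8.
pose s k x := 2 ^+ k * (w k.+1 x - w k x) ^+ 2.
have s0 k x : 0 <= s k x by apply: mulr_ge0; [exact: exprn_ge0|exact: sqr_ge0].
have ms k : measurable_fun setT (s k).
  by apply: measurable_funM => //; apply: measurable_funX; exact: measurable_funB.
pose S x : \bar R := (\sum_(k <oo) (s k x)%:E)%E.
have mS : measurable_fun setT S.
  apply: ge0_emeasurable_sum => [k x _ _|k _]; first by rewrite lee_fin.
  exact/measurable_EFinP.
have S0 x : (0 <= S x)%E by apply: nneseries_ge0 => k _ _; rewrite lee_fin.
have iS : (\int[mu]_x S x < +oo)%E.
  rewrite integral_nneseries//; last 2 first.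
  - by move=> k; exact/measurable_EFinP.
  - by move=> k x _; rewrite lee_fin.
  have sk k : (\int[mu]_x (s k x)%:E <= (1 * 2^-1 ^+ k)%:E)%E.
    under eq_integral do rewrite EFinM.
    rewrite ge0_integralZl//; last 2 first.
    - apply/measurable_EFinP; apply: measurable_funX; exact: measurable_funB.
    - by move=> x _; rewrite lee_fin sqr_ge0.
    apply: (@le_trans _ _ ((2 ^+ k)%:E * (8^-1 ^+ k)%:E)%E).
      by apply: lee_wpmul2l => //; rewrite lee_fin.
    rewrite -EFinM lee_fin mul1r -exprMn lerXn2r// ?nnegrE//; lra.
  apply: (@le_lt_trans _ _ (\sum_(k <oo) (1 * 2^-1 ^+ k)%:E)%E).
    apply: lee_nneseries => k *; last exact: sk.
    by apply: integral_ge0 => x _; rewrite lee_fin.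
  have h : `|2^-1 : R| < 1 by rewrite ger0_norm// invf_lt1// ltr1n.
  rewrite (_ : (fun n => _) = EFin \o series (geometric 1 2^-1)); last first.
    by apply/funext => n; rewrite /= /series/= -sumEFin.
  rewrite EFin_lim ?ltry//.
  exact: is_cvg_geometric_series.
have Sfin : {ae mu, forall x, S x \is a fin_num}.
  have iSS : mu.-integrable setT S.
    apply/integrableP; split => //.
    by under eq_integral do rewrite gee0_abs//.
  by have := integrable_ae measurableT iSS; apply: filterS => x; apply.
have cw x : S x \is a fin_num -> cvgn (w ^~ x).
  move=> Sx; apply: summable_cvg.
  apply: nnseries_is_cvg => [k|]; first exact: s0.
  by rewrite -ge0_fin_numE; [exact: Sx|exact: S0].
(* multiplying by the indicator of D makes the sequence converge everywhere *)
pose D := [set x | S x \is a fin_num].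
have mD : measurable D.
  by rewrite -[D]setTI; exact: emeasurable_fin_num.
pose v (x : T) : R := limn (fun k => w k x * \1_D x).
have wv x : (fun k => w k x * \1_D x) @ \oo --> v x.
  have [Dx|nDx] := pselect (D x).
    apply: is_cvgM; [exact: cw|exact: is_cvg_cst].
  by rewrite /v indicE memNset//=; under eq_fun do rewrite mulr0; exact: is_cvg_cst.
exists v.
  apply: (@measurable_fun_cvg _ _ _ _ (fun k x => w k x * \1_D x)) => //.
  by move=> k; apply: measurable_funM => //; exact: measurable_indic.
apply: filterS Sfin => x Sx; have := wv x.
by rewrite indicE mem_set//; under eq_fun do rewrite mulr1.
Qed.

End riesz_fischer.

Section product_ae.
Context d (T : measurableType d) (R : realType).
Variable mu : {sigma_finite_measure set T -> \bar R}.

Lemma ae_fst (P : T -> Prop) :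
  {ae mu, forall x, P x} -> {ae (mu \x mu)%E, forall z, P z.1}.
Proof.
move=> [N [mN N0 PN]]; exists (N `*` setT); split.
- exact: measurableX.
- by rewrite product_measure1E// [X in (X * _)%E](_ : _ = 0%E) ?mul0e.
- by move=> -[x y] /= nP; split=> //=; apply: PN.
Qed.

Lemma ae_snd (P : T -> Prop) :
  {ae mu, forall x, P x} -> {ae (mu \x mu)%E, forall z, P z.2}.
Proof.
move=> [N [mN N0 PN]]; exists (setT `*` N); split.
- exact: measurableX.
- by rewrite product_measure1E// [X in (_ * X)%E](_ : _ = 0%E) ?mule0.
- by move=> -[x y] /= nP; split=> //=; apply: PN.
Qed.

Lemma measurable_diff (u v : T -> R) :
  measurable_fun setT u -> measurable_fun setT v ->
  measurable_fun setT (fun z : T * T => u z.1 - v z.2).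
Proof.
move=> mu_ mv; apply: measurable_funB.
  exact: (measurableT_comp mu_ measurable_fst).
exact: (measurableT_comp mv measurable_snd).
Qed.

End product_ae.

Section sobolev_complete.
Context d (T : measurableType d) (R : realType).
Variable mu : {sigma_finite_measure set T -> \bar R}.
Variable K : T * T -> R.
Hypothesis mK : measurable_fun setT K.
Hypothesis K0 : forall z, 0 <= K z.

Definition sobolev_sq (v : T -> R) : \bar R :=
  (wsq mu (cst 1%R) v +
  wsq (mu \x mu) K (fun z => v z.1 - v z.2)%R)%E.

(** A rapidly Cauchy subsequence has an almost everywhere limit v; letting the
index of the subsequence grow in the norm of u_k - w_j, Fatou's lemma bounds the
norm of u_k - v. *)
Lemma sobolev_complete (u : nat -> T -> R) :
  (forall k, measurable_fun setT (u k)) ->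
  (forall e, 0 < e -> exists N, forall j k, (N <= j)%N -> (N <= k)%N ->
     (sobolev_sq (fun x => u j x - u k x)%R <= e%:E)%E) ->
  exists2 v : T -> R, measurable_fun setT v &
  forall e, 0 < e -> exists N, forall k, (N <= k)%N ->
     (sobolev_sq (fun x => u k x - v x)%R <= e%:E)%E.
Proof.
move=> mu_ cu.
have /choice[N NP] (i : nat) : exists N, forall j k, (N <= j)%N -> (N <= k)%N ->
    (sobolev_sq (fun x => u j x - u k x)%R <= (8^-1 ^+ i)%:E)%E.
  by apply: cu; rewrite exprn_gt0// invr_gt0.
(* adding 1 at each step forces j <= n j, so that the subsequence is cofinal *)
pose n j := (\sum_(i < j.+1) (N i + 1))%N.
have nge j : (N j <= n j)%N /\ (N j <= n j.+1)%N.
  have h : (N j <= n j)%N by rewrite /n big_ord_recr/= addnA; lia.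
  by split => //; apply: (leq_trans h); rewrite /n [leqRHS]big_ord_recr/= leq_addr.
have jn j : (j <= n j)%N.
  elim: j => // j ih; rewrite /n big_ord_recr/= -/(n j); lia.
pose w j := u (n j).
have [v mv wv] : exists2 v : T -> R, measurable_fun setT v &
    {ae mu, forall x, w ^~ x @ \oo --> v x}.
  apply: (@fast_cauchy_ae_cvg _ _ _ mu) => [k|k]; first exact: mu_.
  have [h1 h2] := nge k; apply: le_trans (NP k _ _ h2 h1).
  apply: (@le_trans _ _ (wsq mu (cst 1%R) (fun x => w k.+1 x - w k x)%R)).
    by rewrite /wsq; under [leRHS]eq_integral do rewrite mul1r.
  by apply: leeDl; exact: wsq_ge0 K0.
exists v => // e e0; have [M MP] := cu (e / 2) (divr_gt0 e0 (ltr0Sn R 1)).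
exists M => k Mk.
have near_w j : (M <= j)%N ->
    (sobolev_sq (fun x => u k x - w j x)%R <= (e / 2)%:E)%E.
  by move=> Mj; apply: MP => //; exact: leq_trans (jn j).
rewrite /sobolev_sq (splitr e) EFinD; apply: leeD.
- apply: (@wsq_fatou _ _ _ _ _ (fun j x => u k x - w j x) _ _ M) => //.
  + by move=> j; exact: measurable_funB (mu_ _) (mu_ _).
  + exact: measurable_funB (mu_ _) mv.
  + by apply: filterS wv => x wx; apply: cvgB => //; exact: cvg_cst.
  + by move=> j Mj; apply: le_trans (near_w j Mj); apply: leeDl; exact: wsq_ge0 K0.
- apply: (@wsq_fatou _ _ _ _ _
    (fun j z => (u k z.1 - w j z.1) - (u k z.2 - w j z.2)) _ _ M) => //.
  + by move=> j; apply: (@measurable_diff _ _ _ (fun x => u k x - w j x)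
      (fun x => u k x - w j x)); exact: measurable_funB (mu_ _) (mu_ _).
  + by apply: (@measurable_diff _ _ _ (fun x => u k x - v x)
      (fun x => u k x - v x)); exact: measurable_funB (mu_ _) mv.
  + apply: filterS2 (ae_fst wv) (ae_snd wv) => z w1 w2.
    by apply: cvgB; apply: cvgB => //; exact: cvg_cst.
  + by move=> j Mj; apply: le_trans (near_w j Mj); apply: leeDr; apply: wsq_ge0 => x /=.
Qed.

End sobolev_complete.

Section quadratic_forms.
Variables (R : realType) (V : lmodType R) (X : set V).
Hypothesis subX : subspace_set X.

Lemma quadratic_onD (A B : V -> R) : quadratic_on X A -> quadratic_on X B ->
  quadratic_on X (fun u => A u + B u).
Proof.
move=> [A0 AD AZ] [B0 BD BZ]; split.
- by move=> u Xu; rewrite addr_ge0 ?A0 ?B0.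
- move=> u v Xu Xv; have := AD u v Xu Xv; have := BD u v Xu Xv.
  move: (A _) (A _) (A _) (A _) (B _) (B _) (B _) (B _) => *; lra.
- by move=> a u Xu; rewrite AZ// BZ//; ring.
Qed.

Lemma quadratic_onZ (c : R) (A : V -> R) : 0 <= c -> quadratic_on X A ->
  quadratic_on X (fun u => c * A u).
Proof.
move=> c0 [A0 AD AZ]; split.
- by move=> u Xu; rewrite mulr_ge0 ?A0.
- by move=> u v Xu Xv; rewrite -mulrDr AD//; ring.
- by move=> a u Xu; rewrite AZ//; ring.
Qed.

(** Every term of the energy has this shape: the square of a linear functional
of u, integrated against a nonnegative weight. *)
Lemma quadratic_on_wsq d (T : measurableType d) (mu : {measure set T -> \bar R})
    (K : T -> R) (L : V -> T -> R) :
  measurable_fun setT K -> (forall x, 0 <= K x) ->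
  (forall (a b : R) u v x, L (a *: u + b *: v) x = a * L u x + b * L v x) ->
  (forall u, X u -> measurable_fun setT (L u)) ->
  (forall u, X u -> (wsq mu K (L u) < +oo)%E) ->
  quadratic_on X (fun u => fine (wsq mu K (L u))).
Proof.
move=> mK K0 linL mL Lfin.
have fin u : X u -> wsq mu K (L u) \is a fin_num.
  by move=> Xu; rewrite ge0_fin_numE ?wsq_ge0// Lfin.
have XD u v : X u -> X v -> X (u + v).
  by move=> Xu Xv; have := subX.2 1 1 u v Xu Xv; rewrite !scale1r.
have XB u v : X u -> X v -> X (u - v).
  by move=> Xu Xv; have := subX.2 1 (-1) u v Xu Xv; rewrite scale1r scaleN1r.
have XZ a u : X u -> X (a *: u).
  by move=> Xu; have := subX.2 a 0 u u Xu Xu; rewrite scale0r addr0.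
split.
- by move=> u Xu; apply/fine_ge0/wsq_ge0.
- move=> u v Xu Xv; apply: EFin_inj.
  have f1 := fin _ (XD u v Xu Xv); have f2 := fin _ (XB u v Xu Xv).
  have f3 := fin u Xu; have f4 := fin v Xv.
  rewrite !EFinD !EFinM !fineK//.
  have -> : L (u + v) = fun x => L u x + L v x.
    by apply/funext => x; have := linL 1 1 u v x; rewrite !scale1r !mul1r.
  have -> : L (u - v) = fun x => L u x - L v x.
    apply/funext => x; have := linL 1 (-1) u v x.
    by rewrite scale1r scaleN1r mul1r mulN1r.
  exact: wsq_parallelogram mK K0 (mL u Xu) (mL v Xv).
- move=> a u Xu; apply: EFin_inj.
  have f1 := fin _ (XZ a u Xu); have f2 := fin u Xu.
  rewrite EFinM !fineK//.
  have -> : L (a *: u) = fun x => a * L u x.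
    apply/funext => x; have := linL a 0 u u x.
    by rewrite scale0r addr0 mul0r addr0.
  exact: wsqZ mK K0 (mL u Xu).
Qed.

End quadratic_forms.

(** * Nonlocal forms on a product space and coercivity *)

Section product_forms.
Context d (T : measurableType d) (R : realType).
Variable mu : {sigma_finite_measure set T -> \bar R}.
Implicit Types (A B : set T) (u v : T -> R) (K : T * T -> R).

Definition indic2 A B (z : T * T) : R := \1_A z.1 * \1_B z.2.

Lemma indic2_ge0 A B z : 0 <= indic2 A B z.
Proof. by rewrite mulr_ge0. Qed.

Lemma measurable_indic2 A B : measurable A -> measurable B ->
  measurable_fun setT (indic2 A B).
Proof.
move=> mA mB; apply: measurable_funM.
  by apply: measurableT_comp measurable_fst => //; exact: measurable_indic.
by apply: measurableT_comp measurable_snd => //; exact: measurable_indic.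
Qed.

Lemma iterated_integral_indic A B (f : T * T -> R) :
  measurable A -> measurable B ->
  measurable_fun setT f -> (forall z, 0 <= f z) ->
  (\int[mu]_(x in A) \int[mu]_(y in B) (f (x, y))%:E =
   \int[mu \x mu]_z (indic2 A B z * f z)%:E)%E.
Proof.
move=> mA mB mf f0; rewrite (fubini_tonelli1 (fun z => (indic2 A B z * f z)%:E)).
- rewrite integral_mkcond; apply: eq_integral => x _; rewrite /fubini_F patchE.
  case: ifPn => xA.
  + rewrite [LHS]integral_mkcond; apply: eq_integral => y _; rewrite patchE.
    rewrite /indic2/= !indicE xA mul1r.
    by case: ifPn => yB; rewrite ?mul1r ?mul0r.
  + under eq_integral do rewrite /indic2/= indicE (negbTE xA) !mul0r.
    by rewrite integral0.
- apply/measurable_EFinP; apply: measurable_funM => //; exact: measurable_indic2.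
- by move=> z; rewrite lee_fin mulr_ge0// indic2_ge0.
Qed.

Lemma wsq_fst K u : measurable_fun setT K -> (forall z, 0 <= K z) ->
  measurable_fun setT u ->
  (wsq (mu \x mu) K (fun z => u z.1) =
   \int[mu]_x ((u x ^+ 2)%:E * \int[mu]_y (K (x, y))%:E))%E.
Proof.
move=> mK K0 mu_; rewrite /wsq (fubini_tonelli1 (fun z => (K z * u z.1 ^+ 2)%:E)).
- apply: eq_integral => x _; rewrite /fubini_F/= -ge0_integralZl//.
  + by apply: eq_integral => y _; rewrite -EFinM mulrC.
  + apply/measurable_EFinP.
    exact: (measurableT_comp mK (pair1_measurable x)).
  + by move=> y _; rewrite lee_fin.
  + by rewrite lee_fin sqr_ge0.
- apply: measurable_wsq => //.
  by apply: measurableT_comp measurable_fst.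
- by move=> z; rewrite lee_fin mulr_ge0 ?sqr_ge0.
Qed.

Lemma wsq_snd K u : measurable_fun setT K -> (forall z, 0 <= K z) ->
  measurable_fun setT u ->
  (wsq (mu \x mu) K (fun z => u z.2) =
   \int[mu]_y ((u y ^+ 2)%:E * \int[mu]_x (K (x, y))%:E))%E.
Proof.
move=> mK K0 mu_; rewrite /wsq (fubini_tonelli2 (fun z => (K z * u z.2 ^+ 2)%:E)).
- apply: eq_integral => y _; rewrite /fubini_G/= -ge0_integralZl//.
  + by apply: eq_integral => x _; rewrite -EFinM mulrC.
  + apply/measurable_EFinP.
    exact: (measurableT_comp mK (pair2_measurable y)).
  + by move=> x _; rewrite lee_fin.
  + by rewrite lee_fin sqr_ge0.
- apply: measurable_wsq => //.
  by apply: measurableT_comp measurable_snd.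
- by move=> z; rewrite lee_fin mulr_ge0 ?sqr_ge0.
Qed.

Lemma wsq_fst_le K u M : measurable_fun setT K -> (forall z, 0 <= K z) ->
  measurable_fun setT u -> 0 <= M ->
  (forall x, (\int[mu]_y (K (x, y))%:E <= M%:E)%E) ->
  (wsq (mu \x mu) K (fun z => u z.1) <= M%:E * wsq mu (cst 1%R) u)%E.
Proof.
move=> mK K0 mu_ M0 KM; rewrite wsq_fst// /wsq -ge0_integralZl//.
- apply: ge0_le_integral => //.
  + by move=> x _; apply: mule_ge0; [rewrite lee_fin sqr_ge0|
      apply: integral_ge0 => y _; rewrite lee_fin].
  + apply: emeasurable_funM; first by apply/measurable_EFinP; exact: measurable_funX.
    apply: (measurable_fun_fubini_tonelli_F (fun z => (K z)%:E)).
      exact/measurable_EFinP.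
    by move=> z; rewrite lee_fin.
  + by apply: measurable_funeM; apply: measurable_wsq.
  + move=> x _; rewrite /= mul1r [leRHS]muleC; apply: lee_wpmul2l => //.
    by rewrite lee_fin sqr_ge0.
- exact: measurable_wsq.
- by move=> x _; rewrite lee_fin mulr_ge0 ?sqr_ge0.
Qed.

Lemma wsq_snd_le K u M : measurable_fun setT K -> (forall z, 0 <= K z) ->
  measurable_fun setT u -> 0 <= M ->
  (forall y, (\int[mu]_x (K (x, y))%:E <= M%:E)%E) ->
  (wsq (mu \x mu) K (fun z => u z.2) <= M%:E * wsq mu (cst 1%R) u)%E.
Proof.
move=> mK K0 mu_ M0 KM; rewrite wsq_snd// /wsq -ge0_integralZl//.
- apply: ge0_le_integral => //.
  + by move=> x _; apply: mule_ge0; [rewrite lee_fin sqr_ge0|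
      apply: integral_ge0 => y _; rewrite lee_fin].
  + apply: emeasurable_funM; first by apply/measurable_EFinP; exact: measurable_funX.
    apply: (measurable_fun_fubini_tonelli_G (fun z => (K z)%:E)).
      exact/measurable_EFinP.
    by move=> z; rewrite lee_fin.
  + by apply: measurable_funeM; apply: measurable_wsq.
  + move=> x _; rewrite /= mul1r [leRHS]muleC; apply: lee_wpmul2l => //.
    by rewrite lee_fin sqr_ge0.
- exact: measurable_wsq.
- by move=> x _; rewrite lee_fin mulr_ge0 ?sqr_ge0.
Qed.

End product_forms.
Arguments indic2 {d T R} A B z.

Section coercivity.
Context d (T : measurableType d) (R : realType).
Variable mu : {sigma_finite_measure set T -> \bar R}.
Variables (K : T * T -> R) (O O' W : set T) (c C m : R).
Hypothesis mK : measurable_fun setT K.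
Hypothesis K0 : forall z, 0 <= K z.
Hypotheses (mO' : measurable O') (mW : measurable W).
Hypothesis muW : mu W = 1%E.
Hypothesis muO' : (mu O' <= m%:E)%E.
Hypotheses (OO' : O `&` O' = set0) (WO : W `&` O = set0) (WO' : W `&` O' = set0).
Hypotheses (c0 : 0 < c) (C0 : 0 <= C).
Hypothesis Kfar : forall x y, O x -> W y -> c <= K (x, y).
Hypothesis Knear : forall x y, O x -> O' y -> K (x, y) <= C /\ K (y, x) <= C.

Let sq0 (k t : R) : 0 <= k -> 0 <= k * t ^+ 2.
Proof. by move=> k0; rewrite mulr_ge0// sqr_ge0. Qed.

Let m0 : 0 <= m.
Proof. by rewrite -lee_fin (le_trans _ muO'). Qed.

Definition censored_sq (v : T -> R) : \bar R :=
  wsq (mu \x mu)%E (fun z => indic2 (~` O') (~` O') z * K z)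
    (fun z => v z.1 - v z.2).

Let KO' z := indic2 (~` O') (~` O') z * K z.

Let mKO' : measurable_fun setT KO'.
Proof.
by apply: measurable_funM => //; apply: measurable_indic2; exact: measurableC.
Qed.

Let KO'_ge0 z : 0 <= KO' z.
Proof. by rewrite mulr_ge0// indic2_ge0. Qed.

Variable v : T -> R.
Hypothesis mv : measurable_fun setT v.
Hypothesis vO : {ae mu, forall x, O x \/ v x = 0}.

Let mdv : measurable_fun setT (fun z : T * T => v z.1 - v z.2).
Proof. exact: measurable_diff. Qed.

Let mv1 : measurable_fun setT (fun z : T * T => v z.1).
Proof. by apply: measurableT_comp measurable_fst. Qed.

Let mv2 : measurable_fun setT (fun z : T * T => v z.2).
Proof. by apply: measurableT_comp measurable_snd. Qed.

Let notO' x : O x -> ~ O' x.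
Proof. by move=> Ox O'x; have : set0 x by rewrite -OO'. Qed.

(** For x in O and y in W, v y = 0 and the kernel is at least c, so that
c v(x)^2 is below the integrand; integrate over the mass-one set W. *)
Lemma poincare_far : (wsq mu (cst 1%R) v <= c^-1%:E * censored_sq v)%E.
Proof.
have -> : wsq mu (cst 1%R) v = wsq (mu \x mu)%E (indic2 setT W) (fun z => v z.1).
  rewrite wsq_fst//; last 2 first.
  - exact: measurable_indic2.
  - by move=> z; exact: indic2_ge0.
  apply: eq_integral => x _; rewrite mul1r.
  rewrite (_ : \int[mu]_y _ = 1)%E ?mule1//.
  under eq_integral do rewrite /indic2/= indicT mul1r.
  by rewrite integral_indic// setIT.
apply: wsq_le_ae => //.
- exact: measurable_indic2.
- by move=> z; exact: indic2_ge0.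
- by rewrite invr_ge0 ltW.
apply: filterS2 (ae_fst vO) (ae_snd vO) => -[x y] /= vx vy.
have rhs0 : 0 <= c^-1 * (KO' (x, y) * (v x - v y) ^+ 2).
  by rewrite mulr_ge0 ?sq0// invr_ge0 ltW.
rewrite {1}/indic2/= indicT mul1r indicE.
have [/set_mem Wy|_] := boolP (y \in W); last by rewrite mul0r.
case: vx => [Ox|vx0]; last by rewrite {1}vx0 expr0n mulr0; exact: rhs0.
have -> : v y = 0.
  by case: vy => // Oy; have : set0 y by rewrite -WO.
have NO'y : ~ O' y by move=> O'y; have : set0 y by rewrite -WO'.
rewrite subr0 mul1r mulrA /KO' /indic2/= !indicE !mem_set//=; last exact: notO'.
rewrite ?mul1r ?mulr1 ler_peMl ?sqr_ge0//.
by rewrite ler_pdivlMl// mulr1 Kfar.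
Qed.

(** The pairs that the censored form omits have one point y in O', where v
vanishes; a nonzero contribution then forces the other point x into O, where the
kernel is at most C and the integrand at most C v(x)^2. *)
Lemma sobolev_le_censored_L2 :
  (wsq (mu \x mu) K (fun z => v z.1 - v z.2)%R <=
   censored_sq v + (2 * C * m)%:E * wsq mu (cst 1%R) v)%E.
Proof.
have mI1 : measurable_fun setT (indic2 setT O' : T * T -> R) by exact: measurable_indic2.
have mI2 : measurable_fun setT (indic2 O' setT : T * T -> R) by exact: measurable_indic2.
have I1m x : (\int[mu]_y (indic2 setT O' (x, y))%:E <= m%:E)%E.
  under eq_integral do rewrite /indic2/= indicT mul1r.
  by rewrite integral_indic// setIT.
have I2m y : (\int[mu]_x (indic2 O' setT (x, y))%:E <= m%:E)%E.
  under eq_integral do rewrite /indic2/= indicT mulr1.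
  by rewrite integral_indic// setIT.
have L1 := wsq_fst_le mI1 (@indic2_ge0 _ _ _ _ _) mv m0 I1m.
have L2 := wsq_snd_le mI2 (@indic2_ge0 _ _ _ _ _) mv m0 I2m.
have ge0 (L h : T * T -> R) z : (forall z, 0 <= L z) -> (0 <= (L z * h z ^+ 2)%:E)%E.
  by move=> L0; rewrite lee_fin sq0.
apply: (@le_trans _ _ (censored_sq v +
   (C%:E * wsq (mu \x mu) (indic2 setT O') (fun z => v z.1) +
    C%:E * wsq (mu \x mu) (indic2 O' setT) (fun z => v z.2)))%E); last first.
  apply: leeD => //.
  have -> : (2 * C * m)%:E = (C%:E * m%:E + C%:E * m%:E)%E.
    by rewrite -!EFinM -EFinD; congr EFin; ring.
  rewrite ge0_muleDl ?lee_fin ?mulr_ge0//.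
  by apply: leeD; rewrite -muleA; apply: lee_wpmul2l; rewrite ?lee_fin.
rewrite /censored_sq /wsq.
rewrite -!ge0_integralZl ?lee_fin//; try exact: measurable_wsq; last 2 first.
- by move=> z _; apply: (ge0 (indic2 O' setT) (fun z => v z.2)) => *; exact: indic2_ge0.
- by move=> z _; apply: (ge0 (indic2 setT O') (fun z => v z.1)) => *; exact: indic2_ge0.
have M1 : measurable_fun setT (fun z : T * T => C%:E * (indic2 setT O' z * v z.1 ^+ 2)%:E)%E.
  by apply: measurable_funeM; exact: measurable_wsq.
have M2 : measurable_fun setT (fun z : T * T => C%:E * (indic2 O' setT z * v z.2 ^+ 2)%:E)%E.
  by apply: measurable_funeM; exact: measurable_wsq.
have M3 : measurable_fun setT (fun z : T * T => (KO' z * (v z.1 - v z.2) ^+ 2)%:E)%E.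
  exact: (measurable_wsq mKO' mdv).
have G1 (z : T * T) : (0 <= C%:E * (indic2 setT O' z * v z.1 ^+ 2)%:E)%E.
  by rewrite -EFinM lee_fin mulr_ge0 ?sq0 ?indic2_ge0.
have G2 (z : T * T) : (0 <= C%:E * (indic2 O' setT z * v z.2 ^+ 2)%:E)%E.
  by rewrite -EFinM lee_fin mulr_ge0 ?sq0 ?indic2_ge0.
have G3 (z : T * T) : (0 <= (KO' z * (v z.1 - v z.2) ^+ 2)%:E)%E.
  by rewrite lee_fin sq0.
rewrite -ge0_integralD// -ge0_integralD//; last 2 first.
- by move=> z _; exact: adde_ge0.
- exact: emeasurable_funD.
apply: ae_ge0_le_integral => //.
- by move=> z _; rewrite lee_fin sq0.
- exact: (measurable_wsq mK mdv).
- by move=> z _; exact: adde_ge0 (G3 z) (adde_ge0 (G1 z) (G2 z)).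
- exact: emeasurable_funD M3 (emeasurable_funD M1 M2).
apply: filterS2 (ae_fst vO) (ae_snd vO) => -[x y] /= vx vy _.
rewrite -!EFinM -!EFinD lee_fin /KO' /indic2/= !indicE !in_setT !mul1r !mulr1 !in_setC.
have z2 : 0 ^+ 2 = 0 :> R by rewrite expr0n.
have [/set_mem O'x|nO'x] := boolP (x \in O').
  have {vx}-> : v x = 0 by case: vx => // /notO'.
  rewrite /= !add0r !mul0r sqrrN z2 !mulr0 !add0r mul1r.
  case: vy => [Oy|->]; last by rewrite z2 !mulr0.
  by apply: ler_wpM2r; rewrite ?sqr_ge0//; have [] := Knear Oy O'x.
have [/set_mem O'y|nO'y] := boolP (y \in O').
  have {vy}-> : v y = 0 by case: vy => // /notO'.
  rewrite /= !subr0 !mulr0 !mul0r mulr0 add0r addr0 mul1r.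
  case: vx => [Ox|->]; last by rewrite z2 !mulr0.
  by apply: ler_wpM2r; rewrite ?sqr_ge0//; have [] := Knear Ox O'y.
by rewrite /= !mul0r !mulr0 !mul1r !addr0.
by move=> z _; exact: G3.
Qed.

Lemma sobolev_coercive :
  (sobolev_sq mu K v <= (c^-1 + 1 + 2 * C * m / c)%:E * censored_sq v)%E.
Proof.
have p0 : (0 <= censored_sq v)%E by exact: wsq_ge0.
have ci : 0 <= c^-1 by rewrite invr_ge0 ltW.
have Cm : 0 <= 2 * C * m by rewrite !mulr_ge0.
apply: (@le_trans _ _ (c^-1%:E * censored_sq v +
   (censored_sq v + (2 * C * m)%:E * (c^-1%:E * censored_sq v)))%E).
  apply: leeD; first exact: poincare_far.
  apply: (le_trans sobolev_le_censored_L2); apply: leeD => //.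
  by apply: lee_wpmul2l; [rewrite lee_fin|exact: poincare_far].
rewrite !EFinD !ge0_muleDl ?lee_fin ?addr_ge0 ?mulr_ge0//.
by rewrite mul1e muleA -EFinM addeA.
Qed.

End coercivity.

Section sobolev_algebra.
Context d (T : measurableType d) (R : realType).
Variable mu : {sigma_finite_measure set T -> \bar R}.
Variable K : T * T -> R.
Hypothesis mK : measurable_fun setT K.
Hypothesis K0 : forall z, 0 <= K z.
Implicit Types u v : T -> R.

Lemma sobolev_sqD_le u v : measurable_fun setT u -> measurable_fun setT v ->
  (sobolev_sq mu K (fun x => u x + v x)%R <=
   2%:E * sobolev_sq mu K u + 2%:E * sobolev_sq mu K v)%E.
Proof.
move=> mu_ mv; rewrite /sobolev_sq.
have distr (a b a' b' : \bar R) : (0 <= a)%E -> (0 <= b)%E -> (0 <= a')%E ->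
    (0 <= b')%E -> (2%:E * (a + b) + 2%:E * (a' + b') =
    (2%:E * a + 2%:E * a') + (2%:E * b + 2%:E * b'))%E.
  by move=> *; rewrite !ge0_muleDr// addeACA.
rewrite distr ?wsq_ge0//.
apply: leeD; first by apply: wsqD_le.
rewrite (_ : (fun z => _) = fun z => (u z.1 - u z.2) + (v z.1 - v z.2)); last first.
  by apply/funext => z; ring.
by apply: wsqD_le => //; exact: measurable_diff.
Qed.

Lemma sobolev_sqZ a u : measurable_fun setT u ->
  (sobolev_sq mu K (fun x => a * u x)%R = (a ^+ 2)%:E * sobolev_sq mu K u)%E.
Proof.
move=> mu_; rewrite /sobolev_sq.
have distr (a' b : \bar R) : (0 <= a')%E -> (0 <= b)%E ->
    ((a ^+ 2)%:E * (a' + b) = (a ^+ 2)%:E * a' + (a ^+ 2)%:E * b)%E.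
  by move=> *; rewrite ge0_muleDr.
rewrite distr ?wsq_ge0// wsqZ//; congr (_ + _)%E.
rewrite (_ : (fun z => _) = fun z => a * (u z.1 - u z.2)); last first.
  by apply/funext => z; ring.
by rewrite wsqZ//; exact: measurable_diff.
Qed.

Lemma sobolev_sq_lincomb_le a b u v :
  measurable_fun setT u -> measurable_fun setT v ->
  (sobolev_sq mu K (fun x => a * u x + b * v x)%R <=
   (2 * a ^+ 2)%:E * sobolev_sq mu K u + (2 * b ^+ 2)%:E * sobolev_sq mu K v)%E.
Proof.
move=> mu_ mv; rewrite (EFinM 2 (a ^+ 2)) (EFinM 2 (b ^+ 2)) -!muleA -!sobolev_sqZ//.
by apply: sobolev_sqD_le; exact: measurable_funM.
Qed.

End sobolev_algebra.

(** * Lebesgue measure on Euclidean space *)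

Section lebesgue_rV_facts.
Variable R : realType.

Definition rV_box (n : nat) (A : 'I_n -> set R) : set 'rV[R]_n :=
  [set x | forall i, A i (x ord0 i)].

Lemma measurable_rV_box n (A : 'I_n -> set R) :
  (forall i, measurable (A i)) -> measurable (rV_box A).
Proof.
move=> mA; rewrite (_ : rV_box A = \bigcap_(i in [set: 'I_n])
    ((fun x : 'rV[R]_n => x ord0 i) @^-1` A i)).
  apply: fin_bigcap_measurable => // i _; rewrite -[X in measurable X]setTI.
  exact: measurable_coord.
by apply/seteqP; split => x /= h i; [move=> _|]; exact: h.
Qed.

Definition cube n (M : R) : set 'rV[R]_n := rV_box (fun=> `[- M, M]%classic).

Arguments cube : clear implicits.

Lemma measurable_cube n M : measurable (cube n M).
Proof. by apply: measurable_rV_box => i; exact: measurable_itv. Qed.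

Lemma lebesgue_rV_box_lty n (A : 'I_n -> set R) :
  (forall i, measurable (A i)) ->
  (forall i, (lebesgue_measure (A i) < +oo)%E) ->
  (lebesgue_rV R n (rV_box A) < +oo)%E.
Proof.
move=> mA Afin; rewrite lebesgue_rV_box//.
rewrite ltey_eq; apply/orP; left.
apply: (@big_ind _ (fun x => x \is a fin_num)) => [//|x y|i _].
- exact: fin_numM.
- by rewrite ge0_fin_numE.
Qed.

Lemma lebesgue_rV_cube_lty n M : (lebesgue_rV R n (cube n M) < +oo)%E.
Proof.
apply: lebesgue_rV_box_lty => i; first exact: measurable_itv.
by rewrite lebesgue_measure_itv/=; case: ifP => _; rewrite ?ltry.
Qed.

Lemma lebesgue_rV_sigma_finite n : sigma_finite setT (lebesgue_rV R n).
Proof.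
exists (fun k => cube n k%:R).
  apply/seteqP; split => // x _.
  exists (Num.truncn (\sum_i `|x ord0 i|)).+1 => // i /=.
  rewrite in_itv/= -ler_norml.
  apply: (@le_trans _ _ (\sum_i `|x ord0 i|)); last by apply/ltW/truncnS_gt.
  by rewrite (bigD1 i)//= lerDl sumr_ge0.
by move=> k; split; [exact: measurable_cube|exact: lebesgue_rV_cube_lty].
Qed.

(** The same set function under a name of its own, so that it can carry the
structure of a sigma-finite measure. *)
Definition lebesgue_rVm n : set 'rV[R]_n -> \bar R := lebesgue_rV R n.
Arguments lebesgue_rVm : clear implicits.

HB.instance Definition _ n := @isMeasure.Build _ _ _ (lebesgue_rVm n)
  (measure0 (lebesgue_rV R n)) (measure_ge0 (lebesgue_rV R n))
  (@measure_semi_sigma_additive _ _ _ (lebesgue_rV R n)).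

HB.instance Definition _ n := @Measure_isSigmaFinite.Build _ _ R
  (lebesgue_rVm n) (@lebesgue_rV_sigma_finite n).

Definition lebesgue_rV_sf (n : nat) : {sigma_finite_measure set 'rV[R]_n -> \bar R} :=
  lebesgue_rVm n.
Arguments lebesgue_rV_sf : clear implicits.

End lebesgue_rV_facts.
Arguments cube {R} n M.
Arguments lebesgue_rV_sf R n : clear implicits.

Section reflection_invariance.
Variable R : realType.
Local Notation leb := (@lebesgue_measure R).

Let reflect_measurable (a : R) :
  @measurable_fun _ _ (measurableTypeR R) (measurableTypeR R) setT (fun x => a - x).
Proof. by apply: (@measurable_funB _ R R setT (cst a) id). Qed.

Let reflected (a : R) : {measure set (measurableTypeR R) -> \bar R} :=
  measure_function_pushforward__canonical__measure_function_Measure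
    leb (reflect_measurable a).

Lemma lebesgue_measure_reflect (a : R) (A : set R) : measurable A ->
  leb ((fun x => a - x) @^-1` A) = leb A.
Proof.
move=> mA.
apply/esym; apply: (@lebesgue_measure_unique R (reflected a)) => //.
move=> _ [[b c] _ <-] /=; rewrite /pushforward.
rewrite (_ : _ @^-1` _ = `[a - c, a - b[%classic); last first.
  apply/seteqP; split => x /=; rewrite !in_itv/= => /andP[h1 h2];
    apply/andP; split; lra.
rewrite !lebesgue_measure_itv/= !lte_fin.
rewrite ltrD2l ltrN2; case: ifPn => // _.
by rewrite -!EFinB; congr EFin; lra.
Qed.

Lemma ge0_integral_reflect (a : R) (f : R -> \bar R) :
  measurable_fun setT f -> (forall x, (0 <= f x)%E) ->
  (\int[leb]_x f (a - x)%R = \int[leb]_x f x)%E.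
Proof.
move=> mf f0.
transitivity (\int[reflected a]_x f x)%E.
  by rewrite /reflected/= (ge0_integral_pushforward (reflect_measurable a)).
apply: eq_measure_integral => A mA _.
exact: lebesgue_measure_reflect.
Qed.

Let measurable_rV_consR n : @measurable_fun _ _
  ('rV[R]_n * measurableTypeR R)%type 'rV[R]_n.+1 setT (@rV_cons R n).
Proof. exact: measurable_rV_cons. Qed.

(** Fubini along the recursive definition of the measure. *)
Lemma ge0_integral_rV_cons n (f : 'rV[R]_n.+1 -> \bar R) :
  measurable_fun setT f -> (forall x, (0 <= f x)%E) ->
  (\int[lebesgue_rV R n.+1]_x f x =
   \int[lebesgue_rV_sf R n]_y \int[leb]_t f (rV_cons (y, t)))%E.
Proof.
move=> mf f0.
pose pm := measure_function_pushforward__canonical__measure_function_Measure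
  (lebesgue_rV_sf R n \x leb)%E (@measurable_rV_consR n).
transitivity (\int[pm]_x f x)%E.
  by apply: eq_measure_integral => A mA _.
rewrite /pm (ge0_integral_pushforward (@measurable_rV_consR n))//.
rewrite preimage_setT.
pose g : 'rV[R]_n * measurableTypeR R -> \bar R := f \o @rV_cons R n.
rewrite -/g (fubini_tonelli1 g)//.
  by apply: measurableT_comp => //; exact: measurable_rV_consR.
by move=> z; exact: f0.
Qed.

Lemma ge0_integral_rV_reflect n (a : 'rV[R]_n) (f : 'rV[R]_n -> \bar R) :
  measurable_fun setT f -> (forall x, (0 <= f x)%E) ->
  (\int[lebesgue_rV R n]_x f (a - x)%R = \int[lebesgue_rV R n]_x f x)%E.
Proof.
elim: n a f => [|n ih] a f mf f0.
  by apply: eq_integral => x _; rewrite (thinmx0 x) (thinmx0 (a - 0)).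
have mfa : measurable_fun setT (fun x : 'rV[R]_n.+1 => f (a - x)).
  apply: measurableT_comp => //; apply: measurable_fun_rV => i.
  under eq_fun do rewrite !mxE.
  by apply: measurable_funB => //; exact: measurable_coord.
rewrite [RHS](ge0_integral_rV_cons mf f0).
rewrite [LHS](ge0_integral_rV_cons mfa (fun x => f0 (a - x))).
pose a' : 'rV[R]_n := \row_i a ord0 (lift ord0 i).
have consE y t : a - rV_cons (y, t) = rV_cons (a' - y, a ord0 ord0 - t).
  apply/rowP => i; rewrite !mxE /=.
  by case: unliftP => [j ->|->] /=; rewrite ?mxE// !ord1.
under eq_integral => y _.
  under eq_integral do rewrite consE.
  rewrite (@ge0_integral_reflect _ (fun t => f (rV_cons (a' - y, t))))//; last first.
    apply: measurableT_comp => //.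
    apply: (measurableT_comp (@measurable_rV_cons R n)).
    exact: pair1_measurable.
  over.
rewrite [LHS](ih a' (fun y => \int[leb]_t f (rV_cons (y, t)))%E)//.
  pose g : 'rV[R]_n * measurableTypeR R -> \bar R := f \o @rV_cons R n.
  apply: (measurable_fun_fubini_tonelli_F (m2 := leb) g) => [|z].
    by apply: measurableT_comp => //; exact: measurable_rV_consR.
  exact: f0.
by move=> y; apply: integral_ge0.
Qed.

End reflection_invariance.

Section euclidean_space.
Variable R : realType.

Lemma measurable_reflect n (a : 'rV[R]_n) :
  measurable_fun setT (fun y : 'rV[R]_n => a - y).
Proof.
apply: measurable_fun_rV => i; under eq_fun do rewrite !mxE.
by apply: measurable_funB => //; exact: measurable_coord.
Qed.

Lemma measurable_rV_opp n : measurable_fun setT (fun y : 'rV[R]_n => - y).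
Proof.
rewrite (_ : (fun y => _) = (fun y => 0 - y)); last first.
  by apply/funext => y; rewrite sub0r.
exact: measurable_reflect.
Qed.

Lemma ae_reflect n (a : 'rV[R]_n) (P : 'rV[R]_n -> Prop) :
  {ae lebesgue_rV R n, forall z, P z} ->
  {ae lebesgue_rV R n, forall y, P (a - y)}.
Proof.
move=> [N [mN N0 PN]]; exists ((fun y => a - y) @^-1` N); split.
- by rewrite -[X in measurable X]setTI; exact: measurable_reflect.
- have mN' : measurable ((fun y => a - y) @^-1` N).
    by rewrite -[X in measurable X]setTI; exact: measurable_reflect.
  rewrite -[X in lebesgue_rV R n X]setIT -integral_indic//.
  rewrite (ge0_integral_rV_reflect a (f := fun y => (\1_N y)%:E)).
  + by rewrite integral_indic// setIT.
  + exact/measurable_EFinP/measurable_indic.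
  + by move=> x; rewrite lee_fin.
- by move=> y /= nP; exact: PN.
Qed.

(** The sigma-algebra is generated by the coordinates; an open set is the union
of the countably many rational boxes that it contains. *)
Lemma open_measurable_rV n (A : set 'rV[R]_n) : open A -> measurable A.
Proof.
move=> oA.
pose B (qk : 'rV[rat]_n * nat) : set 'rV[R]_n :=
  rV_box (fun i => ball (ratr (qk.1 ord0 i) : R) qk.2.+1%:R^-1).
pose C qk : set 'rV[R]_n := [set x | B qk `<=` A /\ B qk x].
have -> : A = \bigcup_qk C qk.
  apply/seteqP; split => [x Ax|x [qk _ [BA Bx]]]; last exact: BA.
  have [e /= e0 eA] : exists2 e : R, 0 < e & ball x e `<=` A.
    by apply/nbhs_ballP; exact: oA.
  have [k ke] := exists_natSinv_lt (divr_gt0 e0 (ltr0Sn R 1)).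
  have k0 : 0 < k.+1%:R^-1 :> R by rewrite invr_gt0.
  have /choice[q qP] (i : 'I_n) : exists q : rat,
      ball (ratr q : R) k.+1%:R^-1 (x ord0 i).
    have /rat_in_itvoo[q] : x ord0 i - k.+1%:R^-1 < x ord0 i + k.+1%:R^-1.
      by rewrite ltrBlDr -addrA ltrDl addr_gt0.
    rewrite in_itv/= => /andP[h1 h2]; exists q.
    by rewrite /ball/= ltr_distlC ltrBlDr h2 -ltrBlDr h1.
  exists (\row_i q i, k) => //; split; last by move=> i /=; rewrite mxE.
  move=> y By; apply: eA; split => // i j; have -> : i = ord0 by exact: ord1.
  have := By j; have := qP j; rewrite /= mxE /ball/= !ltr_norml.
  move=> /andP[h1 h2] /andP[h3 h4]; move: ke h1 h2 h3 h4.
  move: (_^-1) (ratr _) (x _ _) (y _ _) => a b t u *.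
  by apply/andP; split; lra.
apply: countable_bigcupT_measurable => [|qk]; first exact: countableP.
have mB : measurable (B qk).
  by apply: measurable_rV_box => i; apply: open_measurable; exact: ball_open.
have [BA|nBA] := pselect (B qk `<=` A).
  by rewrite (_ : C qk = B qk)//; apply/seteqP; split => [x []|x Bx].
by rewrite (_ : C qk = set0)//; apply/seteqP; split => [x []|x].
Qed.

Lemma continuous_measurable_rV n (f : 'rV[R]_n -> R) :
  continuous f -> measurable_fun setT f.
Proof.
move=> /continuousP cf; apply: (measurability _ (RGenOpens.measurableE R)).
move=> _ [_ [a [b ->] <-]]; rewrite setTI; apply: open_measurable_rV.
exact/cf/interval_open.
Qed.

Lemma measurable_enorm n : measurable_fun setT (@enorm R n).
Proof.
apply: (measurableT_comp (continuous_measurable_fun (@sqrt_continuous R))).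
apply: measurable_sum => i; apply: measurable_funX; exact: measurable_coord.
Qed.

Lemma measurable_rV_sub n :
  measurable_fun setT (fun z : 'rV[R]_n * 'rV[R]_n => z.1 - z.2).
Proof.
apply: measurable_fun_rV => i; under eq_fun do rewrite !mxE.
apply: measurable_funB.
  by apply: (measurableT_comp (@measurable_coord R n i)); exact: measurable_fst.
by apply: (measurableT_comp (@measurable_coord R n i)); exact: measurable_snd.
Qed.

Lemma coord_le_enorm n (x : 'rV[R]_n) i : `|x ord0 i| <= enorm x.
Proof.
rewrite -sqrtr_sqr ler_wsqrtr// (bigD1 i)//= lerDl sumr_ge0// => j _.
exact: sqr_ge0.
Qed.

Lemma enorm_ge0 n (x : 'rV[R]_n) : 0 <= enorm x.
Proof. exact: sqrtr_ge0. Qed.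

Lemma cube_enorm_le n M : exists2 D : R, 0 < D &
  forall x y : 'rV[R]_n, cube n M x -> cube n M y -> enorm (x - y) <= D.
Proof.
exists (Num.sqrt (\sum_(i < n) (2 * M) ^+ 2) + 1).
  by rewrite ltr_wpDl ?sqrtr_ge0.
move=> x y cx cy; apply: (@le_trans _ _ (Num.sqrt (\sum_(i < n) (2 * M) ^+ 2))).
  rewrite ler_wsqrtr// ler_sum// => i _; rewrite !mxE.
  have := cx i; have := cy i; rewrite /= !in_itv/= => /andP[h1 h2] /andP[h3 h4].
  rewrite -subr_ge0 subr_sqr; move: (x _ _) (y _ _) h1 h2 h3 h4 => a b *.
  by apply: mulr_ge0; lra.
by rewrite lerDl.
Qed.

Lemma bounded_cube n (A : set 'rV[R]_n) :
  bounded_set A -> exists2 M : R, 0 < M & A `<=` cube n M.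
Proof.
move=> [M [Mreal AM]]; exists (`|M| + 1); first by rewrite ltr_wpDl.
move=> x Ax i /=; rewrite in_itv/= -ler_norml.
have : `|x| <= `|M| + 1 by apply: AM => //; have := ler_norm M; lra.
apply: le_trans.
have /mapP[j Hj ->] : `|x ord0 i| \in [seq `|x k.1 k.2| | k : 'I_1 * 'I_n].
  by apply/mapP; exists (ord0, i) => //=; rewrite mem_enum.
by rewrite [leRHS]/Num.norm /= mx_normrE; apply/bigmax_geP; right => /=; exists j.
Qed.

(** Near each point of the compact closure of A a uniform lower bound holds;
compactness makes it global. *)
Lemma separated_compacts n (A B : set 'rV[R]_n) : bounded_set A ->
  closure A `&` closure B = set0 ->
  exists2 e : R, 0 < e & forall x y, A x -> B y -> e <= enorm (x - y).
Proof.
move=> bA AB0.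
have cA : compact (closure A).
  have [M M0 AM] := bounded_cube bA.
  have cM : compact (cube n M : set 'rV[R]_n).
    apply: (@rV_compact _ _ (fun=> `[- M, M]%classic)) => _.
    exact: segment_compact.
  apply: (subclosed_compact _ cM); first exact: closed_closure.
  have /closure_id -> : closed (cube n M : set 'rV[R]_n).
    by apply: compact_closed => //; exact: norm_hausdorff.
  exact: closure_subset.
have [|e /= e0 eP] := (compact_near_coveringP _).1 cA R 0^'+
    (fun e x => forall y, B y -> e <= enorm (x - y)) _.
  move=> x Ax.
  have : ~ closure B x by move=> Bx; have : set0 x by rewrite -AB0.
  rewrite /closure /= => /existsNP[U /not_implyP[Ux /nonemptyPn BU]].
  have [d /= d0 dU] : exists2 d : R, 0 < d & ball x d `<=` U by exact/nbhs_ballP.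
  have d2 : 0 < d / 2 by rewrite divr_gt0.
  exists (ball x (d / 2), [set e | e < d / 2]) => /=.
    by split; [exact: nbhsx_ballx|exact: nbhs_right_lt].
  move=> -[x' e] /= [xx' ed] y By; rewrite leNgt; apply/negP => xye.
  suff : set0 y by []; rewrite -BU; split => //; apply: dU; split => // i j; have -> : i = ord0 by exact: ord1.
  case: xx' => _ /(_ ord0 j); rewrite /ball/= => h1.
  have := coord_le_enorm (x' - y) j; rewrite !mxE => h2.
  by have := ler_distD (x' ord0 j) (x ord0 j) (y ord0 j); lra.
exists (e / 2); first by rewrite divr_gt0.
move=> x y Ax By; apply: eP => //=.
- by rewrite sub0r normrN ger0_norm; lra.
- lra.
- exact: subset_closure.
Qed.

End euclidean_space.

(** * Positivity of the constant of the fractional Laplacian *)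

Section gamma_positive.
Variable R : realType.
Local Notation leb := (@lebesgue_measure R).
Implicit Types a t : R.

Definition gamma_integrand a t : R := t `^ (a - 1) * expR (- t).

Lemma gamma_integrand_ge0 a t : 0 <= gamma_integrand a t.
Proof. by rewrite mulr_ge0 ?powR_ge0 ?expR_ge0. Qed.

Lemma measurable_gamma_integrand a : measurable_fun setT (gamma_integrand a).
Proof.
apply: measurable_funM; first exact: measurable_powR.
by apply: measurableT_comp => //; exact: measurableT_comp.
Qed.

(** From t <= b expR (t / b) with b = 2 a: t^a is at most b^a expR (t / 2). *)
Lemma gamma_integrand_tail a t : 0 < a -> 1 <= t ->
  gamma_integrand a t <= (2 * a) `^ a * 2 * exponential_pdf (2^-1) t.
Proof.
move=> a0 t1; have t0 : 0 <= t by lra.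
rewrite exponential_pdfE// /gamma_integrand.
have h : t `^ (a - 1) <= (2 * a) `^ a * expR (t / 2).
  apply: (@le_trans _ _ (t `^ a)); first by apply: ler_powR => //; lra.
  have ->: expR (t / 2) = expR (t / (2 * a)) `^ a.
    by rewrite -expRM; congr expR; field; lra.
  rewrite -powRM ?expR_ge0//; last by lra.
  apply: ge0_ler_powR => //; rewrite ?nnegrE//; first lra.
    by rewrite mulr_ge0 ?expR_ge0//; lra.
  have := expR_ge1Dx (t / (2 * a)); rewrite -ler_pdivrMl; last by lra.
  by rewrite mulrC; lra.
apply: (le_trans (ler_wpM2r (expR_ge0 _) h)).
rewrite -[leLHS]mulrA -expRD (_ : t / 2 - t = - 2^-1 * t); last by lra.
by rewrite -!mulrA ler_wpM2l ?powR_ge0// mulrA divff ?mul1r.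
Qed.

Let r a : R := 2^-1 `^ a.
Let I k : set R := `]2^-1 ^+ k.+1, 2^-1 ^+ k]%classic.

Let r_ge0 a : 0 <= r a. Proof. exact: powR_ge0. Qed.

Let r_lt1 a : 0 < a -> r a < 1.
Proof.
move=> a0; rewrite /r /powR gt_eqF ?invr_gt0// -[ltRHS]expR0 ltr_expR.
by rewrite pmulr_rlt0// ln_lt0//; apply/andP; split; lra.
Qed.

Let dyadic_cover t : 0 < t -> t < 1 -> exists k, I k t.
Proof.
move=> t0 t1.
have ex : exists k, 2^-1 ^+ k.+1 < t.
  have h : `|2^-1 : R| < 1 by rewrite ger0_norm ?invr_ge0// invf_lt1// ltr1n.
  have := cvg_geometric (1 : R) h => /cvgr_lt /(_ t t0) [N _ /(_ N.+1)].
  by rewrite /geometric /= mul1r leqnSn => /(_ isT) ?; exists N.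
case: (ex_minnP ex) => -[|k] kt kmin; last first.
  exists k.+1; rewrite /I/= in_itv/= kt/= leNgt; apply/negP => h.
  by have := kmin _ h; rewrite ltnn.
by exists 0%N; rewrite /I/= in_itv/= kt/= expr0 ltW.
Qed.

(** On the k-th dyadic interval t^a <= 2^(-ka) and 1/t <= 2^(k+1); times the
length 2^(-k-1) this is summable. *)
Lemma gamma_integrand_dyadic a t k : 0 < a -> I k t ->
  gamma_integrand a t <= 2 ^+ k.+1 * r a ^+ k.
Proof.
move=> a0; rewrite /I /= in_itv/= => /andP[kt tk].
have k0 : 0 < 2^-1 ^+ k.+1 :> R by rewrite exprn_gt0// invr_gt0.
have t0 : 0 < t := lt_trans k0 kt.
rewrite /gamma_integrand powRD; last by rewrite (gt_eqF t0) implybT.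
rewrite (powR_inv1 (ltW t0)).
have ta : t `^ a <= r a ^+ k.
  apply: (@le_trans _ _ ((2^-1 ^+ k) `^ a)).
    apply: ge0_ler_powR => //; rewrite ?nnegrE; first exact: ltW.
      exact: ltW.
    by rewrite exprn_ge0// invr_ge0.
  rewrite le_eqVlt; apply/orP; left; apply/eqP; elim: (k) => [|m ih].
    by rewrite !expr0 powR1.
  by rewrite !exprS powRM ?ih// ?exprn_ge0 ?invr_ge0.
have tV : t^-1 <= 2 ^+ k.+1.
  by rewrite -[leRHS]invrK lef_pV2 ?posrE ?invr_gt0 ?exprn_gt0// -exprVn ltW.
have e1 : expR (- t) <= 1 by rewrite -expR0 ler_expR; lra.
rewrite [leRHS]mulrC -[leRHS]mulr1.
have tV0 : 0 <= t^-1 by rewrite invr_ge0 ltW.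
apply: ler_pM; rewrite ?mulr_ge0 ?expR_ge0 ?powR_ge0//.
by apply: ler_pM => //; exact: powR_ge0.
Qed.

Lemma gamma_integral_lty a : 0 < a ->
  (\int[leb]_(t in `]0%R, +oo[) (gamma_integrand a t)%:E < +oo)%E.
Proof.
move=> a0.
pose D t : \bar R := (\sum_(k <oo) (2 ^+ k.+1 * r a ^+ k * \1_(I k) t)%:E)%E.
pose E t : \bar R := ((2 * a) `^ a * 2 * exponential_pdf (2^-1) t)%:E.
have c0 k : 0 <= 2 ^+ k.+1 * r a ^+ k.
  by apply: mulr_ge0; exact: exprn_ge0.
have mI k : measurable (I k) by exact: measurable_itv.
have lI k : leb (I k) = (2^-1 ^+ k - 2^-1 ^+ k.+1)%:E.
  rewrite /I lebesgue_measure_itv/= lte_fin exprS gtr_pMl ?exprn_gt0 ?invr_gt0//.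
  by rewrite invf_lt1// ltr1n EFinB.
have D0 t : (0 <= D t)%E.
  by apply: nneseries_ge0 => k _ _; rewrite lee_fin mulr_ge0.
have E0 t : (0 <= E t)%E.
  by rewrite lee_fin !mulr_ge0 ?powR_ge0// exponential_pdf_ge0// invr_ge0.
have mDk k : measurable_fun setT (fun t => (2 ^+ k.+1 * r a ^+ k * \1_(I k) t)%:E).
  by apply/measurable_EFinP/measurable_funM => //; exact: measurable_indic.
have mD : measurable_fun setT D.
  by apply: ge0_emeasurable_sum => [k x _ _|k _] //; rewrite lee_fin mulr_ge0.
have mE : measurable_fun setT E.
  apply/measurable_EFinP/measurable_funM => //.
  exact: measurable_exponential_pdf.
apply: (@le_lt_trans _ _ (\int[leb]_t (D t + E t))%E).
  apply: (@le_trans _ _ (\int[leb]_(t in `]0%R, +oo[) (D t + E t))%E).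
    apply: ge0_le_integral => //.
    - by move=> t _; rewrite lee_fin gamma_integrand_ge0.
    - apply: measurable_funTS; apply/measurable_EFinP.
      exact: measurable_gamma_integrand.
    - by apply: measurable_funTS; exact: emeasurable_funD.
    move=> t /=; rewrite in_itv/= andbT => t0.
    have [t1|t1] := leP 1 t.
      by rewrite -[leLHS]add0e; apply: leeD => //; rewrite lee_fin; exact: gamma_integrand_tail.
    rewrite -[leLHS]adde0; apply: leeD => //.
    have [k Ikt] : exists k, I k t.
      exact: dyadic_cover.
    apply: (@le_trans _ _ (\sum_(j < k.+1) (2 ^+ j.+1 * r a ^+ j * \1_(I j) t)%:E)%E).
      rewrite big_ord_recr/= -[leLHS]add0e; apply: leeD.
        by apply: sume_ge0 => j _; rewrite lee_fin mulr_ge0.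
      by rewrite lee_fin indicE mem_set// mulr1; exact: gamma_integrand_dyadic.
    rewrite -(big_mkord xpredT (fun j => (2 ^+ j.+1 * r a ^+ j * \1_(I j) t)%:E)).
    by apply: nneseries_lim_ge => j _ _; rewrite lee_fin mulr_ge0.
  apply: ge0_subset_integral => //; first exact: emeasurable_funD.
  by move=> t _; exact: adde_ge0.
rewrite ge0_integralD//; apply: lte_add_pinfty.
  rewrite integral_nneseries//; last first.
    by move=> k x _; rewrite lee_fin mulr_ge0.
  have Ik k : (\int[leb]_t (2 ^+ k.+1 * r a ^+ k * \1_(I k) t)%:E =
      (1 * r a ^+ k)%:E)%E.
    under eq_integral do rewrite EFinM.
    rewrite ge0_integralZl//; last 2 first.
    - by apply/measurable_EFinP; apply: measurable_indic; exact: mI.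
    - by rewrite lee_fin.
    have mIk := mI k.
    rewrite integral_indic// setIT.
    transitivity ((2 ^+ k.+1 * r a ^+ k)%:E * (2^-1 ^+ k - 2^-1 ^+ k.+1)%:E)%E.
      by congr (_ * _)%E; exact: lI.
    rewrite -EFinM; congr EFin.
    rewrite exprS [in X in _ - X]exprS mul1r !exprVn; field.
    by rewrite expf_neq0.
  have h : `|r a| < 1 by rewrite ger0_norm// r_lt1.
  under eq_eseriesr do rewrite Ik.
  rewrite (_ : (fun n => _) = EFin \o series (geometric 1 (r a))); last first.
    by apply/funext => m; rewrite /= /series/= -sumEFin.
  by rewrite EFin_lim ?ltry//; exact: is_cvg_geometric_series.
rewrite /E; under eq_integral do rewrite EFinM.
rewrite ge0_integralZl//.
- by rewrite integral_exponential_pdf ?invr_gt0// mule1 ltry.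
- by apply/measurable_EFinP; exact: measurable_exponential_pdf.
- by move=> x _; rewrite lee_fin exponential_pdf_ge0// invr_ge0.
- by rewrite lee_fin mulr_ge0 ?powR_ge0.
Qed.

Lemma Gamma_gt0 a : 0 < a -> 0 < Gamma a.
Proof.
move=> a0; rewrite /Gamma; apply: fine_gt0; rewrite gamma_integral_lty// andbT.
have m12 : measurable (`[1%R, 2%R]%classic : set R) by exact: measurable_itv.
pose c : R := 2 `^ (- `|a - 1|) * expR (- 2).
have c0 : 0 < c by rewrite mulr_gt0 ?powR_gt0 ?expR_gt0.
have l12 : leb `[1%R, 2%R]%classic = 1%E.
  by rewrite lebesgue_measure_itv/= lte_fin ltr1n -EFinB; congr EFin; lra.
apply: (@lt_le_trans _ _ (c%:E * leb `[1%R, 2%R]%classic)%E).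
  by rewrite l12 mule1 lte_fin.
rewrite -(integral_cst leb m12).
apply: (@le_trans _ _ (\int[leb]_(t in `[1%R, 2%R]) (gamma_integrand a t)%:E)%E).
  apply: ge0_le_integral => //.
  - by move=> t _; rewrite lee_fin ltW.
  - apply: measurable_funTS; apply/measurable_EFinP.
    exact: measurable_gamma_integrand.
  move=> t /=; rewrite in_itv/= => /andP[t1 t2]; rewrite lee_fin.
  apply: ler_pM; rewrite ?powR_ge0 ?expR_ge0//; last by rewrite ler_expR; lra.
  apply: (@le_trans _ _ (t `^ (- `|a - 1|))); last first.
    by apply: ler_powR => //; rewrite lerNl -normrN ler_norm.
  rewrite !powRN lef_pV2 ?posrE ?powR_gt0//; last by lra.
  by apply: ge0_ler_powR => //; rewrite nnegrE; lra.
apply: ge0_subset_integral => //.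
- apply: measurable_funTS; apply/measurable_EFinP.
  exact: measurable_gamma_integrand.
- by move=> t _; rewrite lee_fin gamma_integrand_ge0.
- by move=> t /=; rewrite !in_itv/= andbT => /andP[t1 _]; lra.
Qed.

Lemma frac_coef_gt0 n (s : R) : 0 < s < 1 -> 0 < frac_coef n s.
Proof.
move=> /andP[s0 s1].
have G1 : 0 < Gamma (s + n%:R / 2) by apply: Gamma_gt0; rewrite ltr_wpDr.
have G2 : 0 < Gamma (1 - s) by apply: Gamma_gt0; lra.
rewrite /frac_coef /frac_laplacian_const.
by rewrite !(divr_gt0, mulr_gt0, powR_gt0)// pi_gt0.
Qed.

End gamma_positive.

(** * Test functions and their closure *)

Section test_functions.
Variables (R : realType) (n : nat).
Implicit Types (O : set 'rV[R]_n) (f g : 'rV[R]_n -> R).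

Lemma partials_lincomb (a b : R) f g l : smooth f -> smooth g ->
  partials l (fun x => a * f x + b * g x) =
  (fun x => a * partials l f x + b * partials l g x).
Proof.
move=> sf sg; elim: l => [//|i l ih]; rewrite /partials/= -!/(partials _ _) ih.
apply/funext => x.
have [_ df] := sf l; have [_ dg] := sg l.
have -> : (fun y => a * partials l f y + b * partials l g y) =
  a *: partials l f + b *: partials l g by [].
by rewrite deriveD ?deriveZ//; apply: derivableZ.
Qed.

Lemma smooth_lincomb (a b : R) f g : smooth f -> smooth g ->
  smooth (fun x => a * f x + b * g x).
Proof.
move=> sf sg l; rewrite partials_lincomb//.
have [cf df] := sf l; have [cg dg] := sg l; split.
  move=> x; apply: (@continuousD _ _ _ (fun y => a * partials l f y)
      (fun y => b * partials l g y)).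
    exact: (@continuousM R _ (cst a) (partials l f) x (@cst_continuous _ _ a x) (cf x)).
  exact: (@continuousM R _ (cst b) (partials l g) x (@cst_continuous _ _ b x) (cg x)).
move=> i x.
have -> : (fun y => a * partials l f y + b * partials l g y) =
  a *: partials l f + b *: partials l g by [].
by apply: derivableD; apply: derivableZ.
Qed.

Lemma partials0 l : partials l (fun _ : 'rV[R]_n => 0 : R) = fun=> 0.
Proof.
elim: l => [//|i l ih]; rewrite /partials/= -!/(partials _ _) ih.
by apply/funext => x; rewrite (_ : (fun=> 0) = cst 0)// derive_cst.
Qed.

Lemma test_function0 O : test_function O (fun=> 0).
Proof.
have E : [set x : 'rV[R]_n | (0 : R) != 0] = set0.
  by apply/seteqP; split => x //=; rewrite eqxx.
split.
- move=> l; rewrite partials0; split; first exact: cst_continuous.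
  by move=> i x; exact: derivable_cst.
- by rewrite E closure0; exact: compact0.
- by rewrite E closure0.
Qed.

Lemma test_function_lincomb (a b : R) O f g :
  test_function O f -> test_function O g ->
  test_function O (fun x => a * f x + b * g x).
Proof.
move=> [sf cf fO] [sg cg gO].
have sub : closure [set x | a * f x + b * g x != 0] `<=`
    closure [set x | f x != 0] `|` closure [set x | g x != 0].
  rewrite -closureU; apply: closure_subset => x /= h.
  have [f0|] := eqVneq (f x) 0; last by left.
  by right; move: h; rewrite f0 mulr0 add0r; apply: contra => /eqP ->; rewrite mulr0.
split; first exact: smooth_lincomb.
- apply: (subclosed_compact _ (compactU cf cg) sub); exact: closed_closure.
- by move=> x /sub[/fO|/gO].
Qed.

Lemma measurable_test_function O f : test_function O f -> measurable_fun setT f.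
Proof.
by move=> [sf _ _]; apply: continuous_measurable_rV; have [] := sf [::].
Qed.

Lemma test_function_out O f x : test_function O f -> ~ O x -> f x = 0.
Proof.
move=> [_ _ fO] nOx; apply: contrapT => /eqP fx; apply/nOx/fO.
exact: subset_closure.
Qed.

End test_functions.

Section htilde.
Variables (R : realType) (n : nat).
Local Notation mu := (lebesgue_rV_sf R n).
Implicit Types (O : set 'rV[R]_n) (s : R) (u v w : 'rV[R]_n -> R).

Definition gker s (z : 'rV[R]_n * 'rV[R]_n) : R :=
  (enorm (z.1 - z.2) `^ (n%:R + 2 * s))^-1.

Lemma gker_ge0 s z : 0 <= gker s z.
Proof. by rewrite invr_ge0 powR_ge0. Qed.

Lemma measurable_gker s : measurable_fun setT (gker s).
Proof.
have m1 : measurable_fun setT (fun z : 'rV[R]_n * 'rV[R]_n => enorm (z.1 - z.2)).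
  by apply: measurableT_comp (@measurable_rV_sub R n); exact: measurable_enorm.
rewrite (_ : gker s = (fun z => enorm (z.1 - z.2) `^ (- (n%:R + 2 * s)))); last first.
  by apply/funext => z; rewrite /gker powRN.
exact: (measurableT_comp (measurable_powR _) m1).
Qed.

Lemma gagliardo_onE O s v : measurable O -> measurable_fun setT v ->
  gagliardo_on O s v =
  wsq (mu \x mu)%E (fun z => indic2 O O z * gker s z) (fun z => v z.1 - v z.2).
Proof.
move=> mO mv.
have mf : measurable_fun setT (fun z => gker s z * (v z.1 - v z.2) ^+ 2).
  apply: measurable_funM; first exact: measurable_gker.
  by apply: measurable_funX; exact: measurable_diff.
have f0 z : 0 <= gker s z * (v z.1 - v z.2) ^+ 2.
  by rewrite mulr_ge0 ?gker_ge0 ?sqr_ge0.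
transitivity (\int[mu]_(x in O) \int[mu]_(y in O)
    (gker s (x, y) * (v x - v y) ^+ 2)%:E)%E.
  by apply: eq_integral => x _; apply: eq_integral => y _; rewrite mulrC.
rewrite (iterated_integral_indic mu mO mO mf f0).
by apply: eq_integral => z _; rewrite mulrA.
Qed.

Lemma Hs_norm_sqrE s v : measurable_fun setT v ->
  Hs_norm_sqr s v = sobolev_sq mu (gker s) v.
Proof.
move=> mv; rewrite /Hs_norm_sqr gagliardo_onE//; congr (_ + _)%E.
  by apply: eq_integral => x _; rewrite mul1r.
by apply: eq_integral => z _; rewrite /indic2 !indicT !mul1r.
Qed.

(** The approximation is stated with the squared distance itself below e,
which combines linearly in the estimates that follow. *)
Lemma HtildeP O s v : Htilde O s v <->
  [/\ measurable_fun setT v, (sobolev_sq mu (gker s) v < +oo)%E &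
    forall e : R, 0 < e -> exists2 phi, test_function O phi &
      (sobolev_sq mu (gker s) (fun x => v x - phi x)%R < e%:E)%E].
Proof.
have W1 w : (0 <= \int[lebesgue_rV R n]_x (w x ^+ 2)%:E)%E.
  by apply: integral_ge0 => x _; rewrite lee_fin sqr_ge0.
have W2 w : (0 <= gagliardo_on setT s w)%E.
  apply: integral_ge0 => x _; apply: integral_ge0 => y _.
  by rewrite lee_fin divr_ge0 ?sqr_ge0 ?powR_ge0.
split.
- move=> [[[mv v2] vs] vphi]; split => //.
    rewrite -Hs_norm_sqrE//; exact: lte_add_pinfty.
  move=> e e0; have [|phi tphi] := vphi (Num.sqrt e); first by rewrite sqrtr_gt0.
  rewrite sqr_sqrtr; last exact: ltW.
  rewrite Hs_norm_sqrE => [h|]; first by exists phi.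
  by apply: measurable_funB => //; exact: measurable_test_function tphi.
- move=> [mv]; rewrite -Hs_norm_sqrE// => vfin vphi; split.
    split; first split => //.
      apply: le_lt_trans vfin; exact: leeDl.
    apply: le_lt_trans vfin; exact: leeDr.
  move=> e e0; have [|phi tphi h] := vphi (e ^+ 2); first by rewrite exprn_gt0.
  exists phi => //; rewrite Hs_norm_sqrE//.
  by apply: measurable_funB => //; exact: measurable_test_function tphi.
Qed.

Lemma Htilde_measurable O s v : Htilde O s v -> measurable_fun setT v.
Proof. by move=> /HtildeP[]. Qed.

Lemma Htilde0 O s : Htilde O s (fun=> 0).
Proof.
have z0 : sobolev_sq mu (gker s) (fun=> 0) = 0%E.
  rewrite /sobolev_sq /wsq !integral0_eq ?adde0// => x _.
    by rewrite subrr expr0n/= mulr0.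
  by rewrite expr0n/= mulr0.
apply/HtildeP; split=> [//||e e0]; first by rewrite z0 ltry.
exists (fun=> 0); first exact: test_function0.
by under [X in sobolev_sq _ _ X]eq_fun do rewrite subr0; rewrite z0 lte_fin.
Qed.

Lemma Htilde_lincomb O s (a b : R) v w : Htilde O s v -> Htilde O s w ->
  Htilde O s (fun x => a * v x + b * w x).
Proof.
move=> /HtildeP[mv vfin vP] /HtildeP[mw wfin wP].
have mg := measurable_gker s; have g0 := gker_ge0 s.
apply/HtildeP; split.
- by apply: measurable_funD; exact: measurable_funM.
- apply: le_lt_trans (sobolev_sq_lincomb_le _ _ _ _ _ _ _) _ => //.
  by apply: lte_add_pinfty; apply: lte_mul_pinfty => //; rewrite lee_fin mulr_ge0 ?sqr_ge0.
move=> e e0.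
pose c := 2 * a ^+ 2 + 2 * b ^+ 2 + 1.
have a2 : 0 <= 2 * a ^+ 2 by rewrite mulr_ge0 ?sqr_ge0.
have b2 : 0 <= 2 * b ^+ 2 by rewrite mulr_ge0 ?sqr_ge0.
have c0 : 0 < c by rewrite /c; lra.
have [phi tphi vphi] := vP (e / c) (divr_gt0 e0 c0).
have [psi tpsi wpsi] := wP (e / c) (divr_gt0 e0 c0).
have mphi := measurable_test_function tphi.
have mpsi := measurable_test_function tpsi.
exists (fun x => a * phi x + b * psi x); first exact: test_function_lincomb.
rewrite (_ : (fun x => _) = fun x => a * (v x - phi x) + b * (w x - psi x)); last first.
  by apply/funext => x; ring.
apply: le_lt_trans (sobolev_sq_lincomb_le _ _ _ _ _ _ _) _ => //.
- exact: measurable_funB.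
- exact: measurable_funB.
apply: (@le_lt_trans _ _ ((2 * a ^+ 2)%:E * (e / c)%:E + (2 * b ^+ 2)%:E * (e / c)%:E)%E).
  by apply: leeD; apply: lee_wpmul2l; rewrite ?lee_fin// ltW.
rewrite -!EFinM -EFinD lte_fin -mulrDl mulrA ltr_pdivrMr// mulrC ltr_pM2l//.
by rewrite /c ltrDl.
Qed.

Lemma Htilde_closed O s v : measurable_fun setT v ->
  (forall e : R, 0 < e -> exists2 w, Htilde O s w &
     (sobolev_sq mu (gker s) (fun x => w x - v x)%R <= e%:E)%E) ->
  Htilde O s v.
Proof.
move=> mv vP; have mg := measurable_gker s; have g0 := gker_ge0 s.
apply/HtildeP; split => //.
  have [w /HtildeP[mw wfin _] wv] := vP 1 ltr01.
  have := sobolev_sq_lincomb_le mu mg g0 1 (-1) mw (measurable_funB mw mv).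
  rewrite (_ : (fun x => _) = v); last by apply/funext => x /=; ring.
  move=> /le_lt_trans; apply; apply: lte_add_pinfty.
    by apply: lte_mul_pinfty => //; rewrite lee_fin mulr_ge0 ?sqr_ge0.
  apply: lte_mul_pinfty => //; first by rewrite lee_fin mulr_ge0 ?sqr_ge0.
  by apply: le_lt_trans wv _; rewrite ltry.
move=> e e0; have e8 : 0 < e / 8 by rewrite divr_gt0.
have [w /HtildeP[mw _ wP] wv] := vP _ e8; have [phi tphi wphi] := wP _ e8.
have mphi := measurable_test_function tphi.
exists phi => //.
have := sobolev_sq_lincomb_le mu mg g0 1 (-1)
  (measurable_funB mw mphi) (measurable_funB mw mv).
rewrite (_ : (fun x => _) = fun x => v x - phi x); last by apply/funext => x /=; ring.
move=> /le_lt_trans; apply.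
apply: (@le_lt_trans _ _ ((2 * 1 ^+ 2)%:E * (e / 8)%:E + (2 * (-1) ^+ 2)%:E * (e / 8)%:E)%E).
  have sq2 (t : R) : (0 <= (2 * t ^+ 2)%:E)%E.
    by rewrite lee_fin; apply: mulr_ge0; last exact: sqr_ge0.
  by apply: leeD; apply: lee_wpmul2l => //; exact: ltW.
rewrite -!EFinM -EFinD lte_fin; lra.
Qed.

(** The mass of v outside O is at most its distance to any test function. *)
Lemma Htilde_vanish O s v : measurable O -> Htilde O s v ->
  {ae lebesgue_rV R n, forall x, O x \/ v x = 0}.
Proof.
move=> mO /HtildeP[mv _ vP].
have mOC : measurable (~` O) by exact: measurableC.
have mv2 : measurable_fun (~` O) (fun x => (v x ^+ 2)%:E).
  by apply/measurable_EFinP; apply: measurable_funTS; exact: measurable_funX.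
have : (\int[lebesgue_rV R n]_(x in ~` O) `|(v x ^+ 2)%:E|)%E = 0%E.
  apply/eqP; rewrite eq_le integral_ge0// andbT.
  apply/lee_addgt0Pr => e e0; rewrite add0e.
  have [phi tphi vphi] := vP _ e0.
  have mvphi : measurable_fun setT (fun x => v x - phi x).
    by apply: measurable_funB => //; exact: measurable_test_function tphi.
  apply: le_trans (ltW vphi).
  apply: (@le_trans _ _ (wsq mu (cst 1%R) (fun x => v x - phi x))); last first.
    by apply: leeDl; apply: wsq_ge0; exact: gker_ge0.
  rewrite (_ : (\int[_]_(x in _) _)%E =
    (\int[mu]_(x in ~` O) (cst 1%R x * (v x - phi x) ^+ 2)%:E)%E); last first.
    apply: eq_integral => x /set_mem/= nOx.
    rewrite ger0_norm ?sqr_ge0// mul1r.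
    by rewrite (test_function_out tphi nOx) subr0.
  apply: ge0_subset_integral => //.
  - by apply: measurable_wsq.
  - by move=> x _; rewrite lee_fin mulr_ge0 ?sqr_ge0.
move=> /(ae_eq_integral_abs (lebesgue_rV R n) mOC mv2); apply: filterS => x h.
have [Ox|nOx] := pselect (O x); [by left|right].
by have := h nOx => -[] /eqP; rewrite sqrf_eq0 => /eqP.
Qed.

End htilde.

(** * Coercivity, coupling and source terms for the two domains *)

Section domain_coercivity.
Variables (R : realType) (n : nat).
Local Notation mu := (lebesgue_rV_sf R n).
Implicit Types (O : set 'rV[R]_n) (s : R) (u v w : 'rV[R]_n -> R).

Lemma enorm_sym (x y : 'rV[R]_n) : enorm (x - y) = enorm (y - x).
Proof.
by congr Num.sqrt; apply: eq_bigr => i _; rewrite !mxE -sqrrN opprB.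
Qed.

Lemma gker_antimono s (x y : 'rV[R]_n) (a : R) : (0 < n)%N -> 0 < s ->
  0 < a -> a <= enorm (x - y) -> gker s (x, y) <= (a `^ (n%:R + 2 * s))^-1.
Proof.
move=> n0 s0 a0 ae; rewrite /gker/= lef_pV2 ?posrE ?powR_gt0//; last exact: lt_le_trans ae.
have n0' : 0 < n%:R :> R by rewrite ltr0n.
by apply: ge0_ler_powR; rewrite ?nnegrE ?enorm_ge0 ?(ltW a0)//; lra.
Qed.

Lemma gker_lower s (x y : 'rV[R]_n) (a : R) : (0 < n)%N -> 0 < s ->
  0 < enorm (x - y) -> enorm (x - y) <= a -> (a `^ (n%:R + 2 * s))^-1 <= gker s (x, y).
Proof.
move=> n0 s0 e0 ae; have a0 := lt_le_trans e0 ae.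
rewrite /gker/= lef_pV2 ?posrE ?powR_gt0//.
have n0' : 0 < n%:R :> R by rewrite ltr0n.
by apply: ge0_ler_powR; rewrite ?nnegrE ?enorm_ge0 ?(ltW a0)//; lra.
Qed.

Lemma bounded_lebesgue_lty O : measurable O -> bounded_set O ->
  (lebesgue_rV R n O < +oo)%E.
Proof.
move=> mO /bounded_cube[M _ OM]; apply: le_lt_trans (@lebesgue_rV_cube_lty R n M).
by apply: le_measure; rewrite ?inE//; exact: measurable_cube.
Qed.

(** The constants come from three geometric facts: a cube W outside both
domains exists, all points lie in a common large cube, and the domains are a
positive distance apart. *)
Lemma domain_coercive O O' s : (0 < n)%N -> 0 < s -> open O -> open O' ->
  bounded_set O -> bounded_set O' -> closure O `&` closure O' = set0 ->
  exists2 C : R, 0 < C & forall v, measurable_fun setT v ->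
    {ae lebesgue_rV R n, forall x, O x \/ v x = 0} ->
    (sobolev_sq mu (gker s) v <= C%:E * wsq (mu \x mu)
      (fun z => indic2 (~` O') (~` O') z * gker s z)%R (fun z => v z.1 - v z.2)%R)%E.
Proof.
move=> n0 s0 oO oO' bO bO' OO'.
have mO := open_measurable_rV oO; have mO' := open_measurable_rV oO'.
have [M1 _ OM1] := bounded_cube bO; have [M2 _ OM2] := bounded_cube bO'.
pose M := Num.max M1 M2.
have cubeS (a b : R) : a <= b -> cube n a `<=` cube n b.
  move=> ab x cx i; have := cx i; rewrite /= !in_itv/= => /andP[h1 h2].
  by apply/andP; split; lra.
have OM : O `<=` cube n M.
  by apply: (subset_trans OM1); apply: cubeS; rewrite le_max lexx.
have O'M : O' `<=` cube n M.
  by apply: (subset_trans OM2); apply: cubeS; rewrite le_max lexx orbT.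
pose i0 : 'I_n := Ordinal n0.
(* a unit cube that the two domains do not meet *)
pose W : set 'rV[R]_n := rV_box (fun=> `[M + 1, M + 2]%classic).
have mW : measurable W by apply: measurable_rV_box => i; exact: measurable_itv.
have Wdisj (A : set 'rV[R]_n) : A `<=` cube n M -> W `&` A = set0.
  move=> AM; apply/seteqP; split => // x [Wx /AM Ax].
  have := Wx i0; have := Ax i0; rewrite /= !in_itv/= => /andP[h1 h2] /andP[h3 h4].
  by lra.
have muW : mu W = 1%E.
  rewrite [LHS](lebesgue_rV_box (A := fun=> `[M + 1, M + 2]%classic)).
    rewrite big1// => i _; rewrite lebesgue_measure_itv/= lte_fin.
    have -> : M + 1 < M + 2 by lra.
    by rewrite -EFinB; congr EFin; lra.
  by move=> i; exact: measurable_itv.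
have [D D0 DP] := @cube_enorm_le R n (`|M| + 2).
have inbig x : cube n M x -> cube n (`|M| + 2) x.
  by apply: cubeS; have := ler_norm M; lra.
have Wbig x : W x -> cube n (`|M| + 2) x.
  move=> Wx i; have := Wx i; rewrite /= !in_itv/= => /andP[h1 h2].
  by have := ler_norm M; have := ler_norm (- M); rewrite normrN => *;
    apply/andP; split; lra.
have [dl dl0 dlP] := separated_compacts bO OO'.
pose p : R := n%:R + 2 * s.
have Kfar x y : O x -> W y -> (D `^ p)^-1 <= gker s (x, y).
  move=> Ox Wy; apply: gker_lower => //; last first.
    by apply: DP; [exact/inbig/OM|exact: Wbig].
  apply: (@lt_le_trans _ _ `|(x - y) ord0 i0|); last exact: coord_le_enorm.
  rewrite normr_gt0 !mxE; have := OM _ Ox i0; have := Wy i0.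
  rewrite /= !in_itv/= => /andP[h1 h2] /andP[h3 h4].
  by apply/eqP => h; lra.
have Knear x y : O x -> O' y -> gker s (x, y) <= (dl `^ p)^-1 /\
    gker s (y, x) <= (dl `^ p)^-1.
  move=> Ox O'y; split; apply: gker_antimono => //; first exact: dlP.
  by rewrite enorm_sym; exact: dlP.
have O'fin : (mu O' < +oo)%E by exact: bounded_lebesgue_lty.
have muO' : (mu O' <= (fine (mu O'))%:E)%E by rewrite fineK// ge0_fin_numE.
have OO'0 : O `&` O' = set0.
  apply/seteqP; split => // x [Ox O'x]; rewrite -OO'.
  by split; exact: subset_closure.
have c0 : 0 < (D `^ p)^-1 by rewrite invr_gt0 powR_gt0.
have C0 : 0 <= (dl `^ p)^-1 by rewrite invr_ge0 powR_ge0.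
exists ((D `^ p)^-1^-1 + 1 + 2 * (dl `^ p)^-1 * fine (mu O') / (D `^ p)^-1).
  have h1 : 0 < (D `^ p)^-1^-1 by rewrite invr_gt0.
  have h2 : 0 <= 2 * (dl `^ p)^-1 * fine (mu O') / (D `^ p)^-1.
    by rewrite !mulr_ge0 ?fine_ge0// ltW.
  by lra.
move=> v mv vO.
exact: (sobolev_coercive (measurable_gker s) (@gker_ge0 R n s) mO' mW muW muO' OO'0
  (Wdisj _ OM) (Wdisj _ O'M) c0 C0 Kfar Knear mv vO).
Qed.

End domain_coercivity.

Section coupling.
Variables (R : realType) (n : nat).
Local Notation mu := (lebesgue_rV_sf R n).
Variables (O1 O2 : set 'rV[R]_n) (J : 'rV[R]_n -> R).
Hypotheses (mO1 : measurable O1) (mO2 : measurable O2).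
Hypothesis mJ : measurable_fun setT J.
Hypothesis J0 : {ae lebesgue_rV R n, forall z, 0 <= J z}.
Hypothesis intJ : (lebesgue_rV R n).-integrable setT (EFin \o J).
Implicit Types u v : 'rV[R]_n -> R.

(** J is nonnegative only almost everywhere; the absolute value makes the
kernel nonnegative everywhere without changing any of the integrals. *)
Definition jker (z : 'rV[R]_n * 'rV[R]_n) : R :=
  indic2 O1 O2 z * `|J (z.1 - z.2)|.

Let mJabs : measurable_fun setT
  (fun z : 'rV[R]_n * 'rV[R]_n => `|J (z.1 - z.2)|).
Proof.
apply: measurableT_comp; first exact: normr_measurable.
exact: measurableT_comp mJ (@measurable_rV_sub R n).
Qed.

Lemma measurable_jker : measurable_fun setT jker.
Proof. by apply: measurable_funM => //; exact: measurable_indic2. Qed.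

Lemma jker_ge0 z : 0 <= jker z.
Proof. by rewrite mulr_ge0 ?indic2_ge0. Qed.

Let Jmass : R := fine (\int[lebesgue_rV R n]_z `|J z|%:E)%E.

Let JmassE : (\int[lebesgue_rV R n]_z `|J z|%:E = Jmass%:E)%E.
Proof.
rewrite fineK// ge0_fin_numE; first by have /integrableP[] := intJ.
by apply: integral_ge0 => z _; rewrite lee_fin.
Qed.

Let Jmass_ge0 : 0 <= Jmass.
Proof. by apply/fine_ge0/integral_ge0 => z _; rewrite lee_fin. Qed.

Let mabsJ : measurable_fun setT (fun z => `|J z|%:E).
Proof. by apply/measurable_EFinP; exact: measurableT_comp. Qed.

Let jker_le x y : jker (x, y) <= `|J (x - y)|.
Proof.
rewrite /jker/= ler_piMl// /indic2/= !indicE.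
by case: (_ \in O1); case: (_ \in O2); rewrite /= ?mulr1 ?mulr0// ler01.
Qed.

Lemma jker_marginal1 x : (\int[mu]_y (jker (x, y))%:E <= Jmass%:E)%E.
Proof.
rewrite -JmassE -(ge0_integral_rV_reflect x mabsJ)//.
apply: ge0_le_integral => //.
- by move=> y _; rewrite lee_fin jker_ge0.
- apply/measurable_EFinP.
  exact: (measurableT_comp measurable_jker (pair1_measurable x)).
- exact: (measurableT_comp mabsJ (@measurable_reflect R n x)).
- by move=> y _; rewrite lee_fin jker_le.
Qed.

Lemma jker_marginal2 y : (\int[mu]_x (jker (x, y))%:E <= Jmass%:E)%E.
Proof.
have mabsJN : measurable_fun setT (fun z : 'rV[R]_n => `|J (- z)|%:E).
  exact: (measurableT_comp mabsJ (@measurable_rV_opp R n)).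
have <- : (\int[lebesgue_rV R n]_z `|J (- z)|%:E = Jmass%:E)%E.
  rewrite -JmassE -(ge0_integral_rV_reflect 0 mabsJ)//.
  by apply: eq_integral => z _; rewrite sub0r.
rewrite -(ge0_integral_rV_reflect y mabsJN)//.
apply: ge0_le_integral => //.
- by move=> x _; rewrite lee_fin jker_ge0.
- apply/measurable_EFinP.
  exact: (measurableT_comp measurable_jker (pair2_measurable y)).
- exact: (measurableT_comp mabsJN (@measurable_reflect R n y)).
- by move=> x _; rewrite lee_fin opprB jker_le.
Qed.

Lemma coupling_energyE u v : measurable_fun setT u -> measurable_fun setT v ->
  (\int[lebesgue_rV R n]_(x in O1) \int[lebesgue_rV R n]_(y in O2)
    (J (x - y) * (u x - v y) ^+ 2)%:E =
   wsq (mu \x mu) jker (fun z => u z.1 - v z.2)%R)%E.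
Proof.
move=> mu_ mv.
have md : measurable_fun setT (fun z : 'rV[R]_n * 'rV[R]_n => (u z.1 - v z.2) ^+ 2).
  by apply: measurable_funX; exact: measurable_diff.
transitivity (\int[mu]_(x in O1) \int[mu]_(y in O2)
    (`|J (x - y)| * (u x - v y) ^+ 2)%:E)%E.
  apply: eq_integral => x _; apply: ae_eq_integral => //.
  - apply: measurable_funTS; apply/measurable_EFinP; apply: measurable_funM.
      exact: (measurableT_comp mJ (@measurable_reflect R n x)).
    exact: (measurableT_comp md (pair1_measurable x)).
  - apply: measurable_funTS; apply/measurable_EFinP; apply: measurable_funM.
      apply: measurableT_comp; first exact: normr_measurable.
      exact: (measurableT_comp mJ (@measurable_reflect R n x)).
    exact: (measurableT_comp md (pair1_measurable x)).
  - by apply: filterS (ae_reflect x J0) => y Jxy _; rewrite ger0_norm.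
rewrite (iterated_integral_indic mu mO1 mO2
  (f := fun z => `|J (z.1 - z.2)| * (u z.1 - v z.2) ^+ 2)).
- by apply: eq_integral => z _; rewrite mulrA.
- exact: measurable_funM.
- by move=> z; rewrite mulr_ge0 ?sqr_ge0.
Qed.

(** Expand the square by (a - b)^2 <= 2 a^2 + 2 b^2; each marginal of the kernel
is at most the mass of |J|. *)
Lemma coupling_energy_le : exists2 C : R, 0 <= C &
  forall u v, measurable_fun setT u -> measurable_fun setT v ->
  (wsq (mu \x mu) jker (fun z => u z.1 - v z.2)%R <=
   C%:E * (wsq mu (cst 1%R) u + wsq mu (cst 1%R) v))%E.
Proof.
exists (2 * Jmass); first by rewrite mulr_ge0.
move=> u v mu_ mv.
have mu1 : measurable_fun setT (fun z : 'rV[R]_n * 'rV[R]_n => u z.1).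
  by apply: measurableT_comp measurable_fst.
have mv2 : measurable_fun setT (fun z : 'rV[R]_n * 'rV[R]_n => v z.2).
  by apply: measurableT_comp measurable_snd.
have mNv2 : measurable_fun setT (fun z : 'rV[R]_n * 'rV[R]_n => -1 * v z.2).
  exact: measurable_funM.
have := wsqD_le (mu \x mu)%E measurable_jker jker_ge0 mu1 mNv2.
rewrite wsqZ//; [|exact: measurable_jker|exact: jker_ge0].
rewrite sqrrN expr1n mul1e.
have -> : (fun z : 'rV[R]_n * 'rV[R]_n => u z.1 + -1 * v z.2) =
    fun z => u z.1 - v z.2 by apply/funext => z; rewrite mulN1r.
move=> h; apply: (le_trans h).
have L1 := wsq_fst_le measurable_jker jker_ge0 mu_ Jmass_ge0 jker_marginal1.
have L2 := wsq_snd_le measurable_jker jker_ge0 mv Jmass_ge0 jker_marginal2.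
have fin (a b a' b' : \bar R) : (0 <= a')%E -> (0 <= b')%E ->
    (a <= Jmass%:E * a')%E -> (b <= Jmass%:E * b')%E ->
    (2%:E * a + 2%:E * b <= (2 * Jmass)%:E * (a' + b'))%E.
  move=> a0 b0 aa bb; rewrite EFinM -muleA ge0_muleDr// ge0_muleDr ?mule_ge0//.
  by apply: leeD; apply: lee_wpmul2l.
by apply: fin => //; apply: wsq_ge0.
Qed.

End coupling.

Section source_term.
Variables (R : realType) (n : nat) (O : set 'rV[R]_n) (f : 'rV[R]_n -> R).
Hypothesis mO : measurable O.
Hypothesis f2 : L2_on O f.
Local Notation mu := (lebesgue_rV R n).
Implicit Types v : 'rV[R]_n -> R.

Let sq_ge0 v x : (0 <= (v x ^+ 2)%:E)%E.
Proof. by rewrite lee_fin sqr_ge0. Qed.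

Lemma source_integrable v : measurable_fun setT v ->
  (\int[mu]_x (v x ^+ 2)%:E < +oo)%E ->
  mu.-integrable O (fun x => (f x * v x)%:E).
Proof.
move=> mv v2; have [mf ff] := f2.
have mvO : measurable_fun O v by exact: measurable_funTS.
have mf2 : measurable_fun O (fun x => (f x ^+ 2)%:E).
  by apply/measurable_EFinP; exact: measurable_funX.
have mv2 : measurable_fun O (fun x => (v x ^+ 2)%:E).
  by apply/measurable_EFinP; exact: measurable_funX.
apply: (@le_integrable _ _ _ _ _ mO _ (fun x => (f x ^+ 2)%:E + (v x ^+ 2)%:E)%E).
- by apply/measurable_EFinP; exact: measurable_funM.
- move=> x Ox; rewrite [leRHS]gee0_abs ?adde_ge0// -EFinD lee_fin normrM.
  rewrite -(real_normK (num_real (f x))) -(real_normK (num_real (v x))).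
  by have := normr_ge0 (f x); have := normr_ge0 (v x);
    move: (`|f x|) (`|v x|) => a b *; nra.
- apply: integrableD => //; apply/integrableP; split => //.
    by under eq_integral do rewrite gee0_abs//.
  under eq_integral do rewrite gee0_abs//.
  apply: le_lt_trans v2; apply: ge0_subset_integral => //.
  by apply/measurable_EFinP; exact: measurable_funX.
Qed.

(** Young's inequality, with a free parameter that lets the second term be
absorbed into the energy. *)
Lemma source_le (e : R) v : 0 < e -> measurable_fun setT v ->
  (\int[mu]_x (v x ^+ 2)%:E < +oo)%E ->
  (\int[mu]_(x in O) (f x * v x)%:E <=
   (4 * e)^-1%:E * \int[mu]_(x in O) (f x ^+ 2)%:E +
   e%:E * \int[mu]_x (v x ^+ 2)%:E)%E.
Proof.
move=> e0 mv v2; have [mf ff] := f2.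
have mvO : measurable_fun O v by exact: measurable_funTS.
have mf2 : measurable_fun O (fun x => (f x ^+ 2)%:E).
  by apply/measurable_EFinP; exact: measurable_funX.
have mv2T : measurable_fun setT (fun x => (v x ^+ 2)%:E).
  by apply/measurable_EFinP; exact: measurable_funX.
have mv2 : measurable_fun O (fun x => (v x ^+ 2)%:E) by exact: measurable_funTS.
have v2O : (\int[mu]_(x in O) (v x ^+ 2)%:E <= \int[mu]_x (v x ^+ 2)%:E)%E.
  exact: ge0_subset_integral.
apply: (@le_trans _ _ ((4 * e)^-1%:E * \int[mu]_(x in O) (f x ^+ 2)%:E +
   e%:E * \int[mu]_(x in O) (v x ^+ 2)%:E)%E); last first.
  by apply: leeD => //; apply: lee_wpmul2l => //; rewrite lee_fin ltW.
have e4 : 0 <= (4 * e)^-1 by rewrite invr_ge0; lra.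
have i1 : mu.-integrable O (fun x => (f x ^+ 2)%:E).
  by apply/integrableP; split => //; under eq_integral do rewrite gee0_abs//.
have i2 : mu.-integrable O (fun x => (v x ^+ 2)%:E).
  apply/integrableP; split => //; under eq_integral do rewrite gee0_abs//.
  exact: le_lt_trans v2.
rewrite -!integralZl// -integralD//; try exact: integrableZl.
apply: le_integral => //.
- exact: source_integrable.
- by apply: integrableD => //; exact: integrableZl.
move=> x _; rewrite -!EFinM -EFinD lee_fin.
rewrite -subr_ge0 (_ : _ - _ = (4 * e)^-1 * (f x - 2 * e * v x) ^+ 2).
  by rewrite mulr_ge0 ?sqr_ge0.
by field; rewrite gt_eqF.
Qed.

End source_term.

(** * The energy on pairs of functions *)

Section nonlocal_energy.
Variables (R : realType) (n : nat) (O1 O2 : set 'rV[R]_n) (J : 'rV[R]_n -> R).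
Variables (s1 s2 : R) (f1 f2 : 'rV[R]_n -> R).
Hypothesis n_gt0 : (0 < n)%N.
Hypotheses (oO1 : open O1) (oO2 : open O2).
Hypotheses (bO1 : bounded_set O1) (bO2 : bounded_set O2).
Hypothesis O12 : closure O1 `&` closure O2 = set0.
Hypothesis mJ : measurable_fun setT J.
Hypothesis J0 : {ae lebesgue_rV R n, forall z, 0 <= J z}.
Hypothesis intJ : (lebesgue_rV R n).-integrable setT (EFin \o J).
Hypotheses (s1_01 : 0 < s1 < 1) (s2_01 : 0 < s2 < 1).
Hypotheses (f1_L2 : L2_on O1 f1) (f2_L2 : L2_on O2 f2).
(* The estimates treat the two weights as positive reals, not as Gamma integrals. *)
Variables (a1 a2 : R).
Hypotheses (a1E : a1 = frac_coef n s1 / 2) (a2E : a2 = frac_coef n s2 / 2).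

Local Notation mu := (lebesgue_rV_sf R n).
Local Notation V := (('rV[R]_n -> R) * ('rV[R]_n -> R))%type.
Implicit Types (u : V) (v w : 'rV[R]_n -> R).

Let mO1 : measurable O1. Proof. exact: open_measurable_rV. Qed.
Let mO2 : measurable O2. Proof. exact: open_measurable_rV. Qed.

Definition H_pair : set V := [set u | Htilde O1 s1 u.1 /\ Htilde O2 s2 u.2].

Lemma subspace_H_pair : subspace_set H_pair.
Proof.
split; first by split; exact: Htilde0.
move=> a b u v [u1 u2] [v1 v2].
split; [exact: (Htilde_lincomb a b u1 v1)|exact: (Htilde_lincomb a b u2 v2)].
Qed.

Definition censored (O : set 'rV[R]_n) s v : \bar R :=
  wsq (mu \x mu)%E (fun z => indic2 (~` O) (~` O) z * gker s z)
    (fun z => v z.1 - v z.2).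

Definition coupled u : \bar R :=
  wsq (mu \x mu)%E (jker O1 O2 J) (fun z => u.1 z.1 - u.2 z.2).

Let sob s v := sobolev_sq mu (gker s) v.

Lemma censored_le (O : set 'rV[R]_n) s v : measurable O -> measurable_fun setT v ->
  (censored O s v <= sob s v)%E.
Proof.
move=> mO mv.
have mk : measurable_fun setT (fun z => indic2 (~` O) (~` O) z * gker s z : R).
  apply: measurable_funM; last exact: measurable_gker.
  by apply: measurable_indic2; exact: measurableC.
apply: (@le_trans _ _ (1%:E * wsq (mu \x mu) (gker s) (fun z => v z.1 - v z.2)%R)%E).
  have md : measurable_fun setT (fun z : 'rV[R]_n * 'rV[R]_n => v z.1 - v z.2).
    exact: measurable_diff.
  apply: wsq_le_ae => //; [|exact: measurable_gker|exact: gker_ge0|].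
    by move=> z; rewrite mulr_ge0 ?indic2_ge0 ?gker_ge0.
  apply: aeW => z; rewrite mul1r ler_wpM2r ?sqr_ge0// ler_piMl ?gker_ge0//.
  rewrite /indic2 !indicE.
  by case: (_ \in _); case: (_ \in _); rewrite /= ?mulr1 ?mulr0// ler01.
by rewrite mul1e; apply: leeDr; apply: wsq_ge0.
Qed.

Let a1_gt0 : 0 < a1. Proof. by rewrite a1E divr_gt0// frac_coef_gt0. Qed.
Let a2_gt0 : 0 < a2. Proof. by rewrite a2E divr_gt0// frac_coef_gt0. Qed.

Definition real_energy u : R :=
  a1 * fine (censored O2 s1 u.1) + a2 * fine (censored O1 s2 u.2) +
  2^-1 * fine (coupled u).

Let sob_lty O s v : Htilde O s v -> (sob s v < +oo)%E.
Proof. by move=> /HtildeP[]. Qed.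

Let L2_le_sob s v : (wsq mu (cst 1%R) v <= sob s v)%E.
Proof. by apply: leeDl; apply: wsq_ge0; exact: gker_ge0. Qed.

Let L2_wsqE v : (\int[lebesgue_rV R n]_x (v x ^+ 2)%:E = wsq mu (cst 1%R) v)%E.
Proof. by apply: eq_integral => x _; rewrite mul1r. Qed.

Let L2_lty O s v : Htilde O s v ->
  (\int[lebesgue_rV R n]_x (v x ^+ 2)%:E < +oo)%E.
Proof.
by move=> /sob_lty; apply: le_lt_trans; rewrite L2_wsqE L2_le_sob.
Qed.

Let censored_ge0 O s v : (0 <= censored O s v)%E.
Proof.
by apply: wsq_ge0 => z; rewrite mulr_ge0 ?indic2_ge0 ?gker_ge0.
Qed.

Let censored1_lty u : H_pair u -> (censored O2 s1 u.1 < +oo)%E.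
Proof.
move=> [h _]; apply: le_lt_trans (sob_lty h).
by apply: censored_le => //; exact: Htilde_measurable h.
Qed.

Let censored2_lty u : H_pair u -> (censored O1 s2 u.2 < +oo)%E.
Proof.
move=> [_ h]; apply: le_lt_trans (sob_lty h).
by apply: censored_le => //; exact: Htilde_measurable h.
Qed.

Lemma coupled_le : exists2 C : R, 0 <= C & forall u, H_pair u ->
  (coupled u <= C%:E * (sob s1 u.1 + sob s2 u.2))%E.
Proof.
have [C C0 CP] := coupling_energy_le mO1 mO2 mJ intJ.
exists C => // u [h1 h2].
apply: (le_trans (CP _ _ (Htilde_measurable h1) (Htilde_measurable h2))).
by apply: lee_wpmul2l; rewrite ?lee_fin//; apply: leeD; exact: L2_le_sob.
Qed.

Let coupled_ge0 u : (0 <= coupled u)%E.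
Proof. by apply: wsq_ge0 => z; exact: jker_ge0. Qed.

Let coupled_lty u : H_pair u -> (coupled u < +oo)%E.
Proof.
move=> Hu; have [C C0 CP] := coupled_le; apply: le_lt_trans (CP _ Hu) _.
have [/sob_lty h1 /sob_lty h2] := Hu.
by apply: lte_mul_pinfty; rewrite ?lee_fin//; exact: lte_add_pinfty.
Qed.

Lemma energyE u : H_pair u ->
  energy O1 O2 J s1 s2 u.1 u.2 = (real_energy u)%:E.
Proof.
move=> Hu; have [h1 h2] := Hu.
have m1 := Htilde_measurable h1; have m2 := Htilde_measurable h2.
rewrite /energy -a1E -a2E coupling_energyE// (gagliardo_onE _ (measurableC mO2) m1).
rewrite (gagliardo_onE _ (measurableC mO1) m2).
have fin (p q r : R) (x y z : \bar R) : x \is a fin_num -> y \is a fin_num ->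
    z \is a fin_num -> (p%:E * x + q%:E * y + r%:E * z =
    (p * fine x + q * fine y + r * fine z)%:E)%E.
  by move: x y z => [x||] [y||] [z||].
apply: fin; rewrite ge0_fin_numE.
- exact: censored1_lty.
- exact: censored_ge0.
- exact: censored2_lty.
- exact: censored_ge0.
- exact: coupled_lty.
- exact: coupled_ge0.
Qed.

Lemma quadratic_real_energy : quadratic_on H_pair real_energy.
Proof.
have mk (O : set 'rV[R]_n) s : measurable O ->
    measurable_fun setT (fun z => indic2 (~` O) (~` O) z * gker s z : R).
  move=> mO; apply: measurable_funM; last exact: measurable_gker.
  by apply: measurable_indic2; exact: measurableC.
have k0 (O : set 'rV[R]_n) s z : 0 <= indic2 (~` O) (~` O) z * gker s z :> R.
  by rewrite mulr_ge0 ?indic2_ge0 ?gker_ge0.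
have q1 : quadratic_on H_pair (fun u : V => fine (censored O2 s1 u.1)).
  apply: (quadratic_on_wsq subspace_H_pair
    (L := fun (u : V) z => u.1 z.1 - u.1 z.2) (mk O2 s1 mO2) (k0 O2 s1)).
  - move=> a b u v z.
    rewrite -[(_ + _).1]/(fun x => a * u.1 x + b * v.1 x) /=; ring.
  - by move=> u [h _]; apply: measurable_diff; exact: Htilde_measurable h.
  - by move=> u Hu; exact: censored1_lty.
have q2 : quadratic_on H_pair (fun u : V => fine (censored O1 s2 u.2)).
  apply: (quadratic_on_wsq subspace_H_pair
    (L := fun (u : V) z => u.2 z.1 - u.2 z.2) (mk O1 s2 mO1) (k0 O1 s2)).
  - move=> a b u v z.
    rewrite -[(_ + _).2]/(fun x => a * u.2 x + b * v.2 x) /=; ring.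
  - by move=> u [_ h]; apply: measurable_diff; exact: Htilde_measurable h.
  - by move=> u Hu; exact: censored2_lty.
have q3 : quadratic_on H_pair (fun u : V => fine (coupled u)).
  apply: (quadratic_on_wsq subspace_H_pair
    (L := fun (u : V) z => u.1 z.1 - u.2 z.2) (measurable_jker mO1 mO2 mJ)
    (@jker_ge0 R n O1 O2 J)).
  - move=> a b u v z.
    rewrite -[(_ + _).1]/(fun x => a * u.1 x + b * v.1 x).
    rewrite -[(_ + _).2]/(fun x => a * u.2 x + b * v.2 x) /=; ring.
  - move=> u [h1 h2]; apply: measurable_diff.
      exact: Htilde_measurable h1.
    exact: Htilde_measurable h2.
  - by move=> u Hu; exact: coupled_lty.
have h0 : 0 <= 2^-1 :> R by rewrite invr_ge0.
exact: (quadratic_onD (quadratic_onD (quadratic_onZ (ltW a1_gt0) q1)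
  (quadratic_onZ (ltW a2_gt0) q2)) (quadratic_onZ h0 q3)).
Qed.

(** The coupling term is nonnegative and can be dropped; each censored form
alone controls the norm of its component. *)
Lemma sobolev_le_energy : exists2 D : R, 0 < D & forall u, H_pair u ->
  (sob s1 u.1 <= (D * real_energy u)%:E)%E /\
  (sob s2 u.2 <= (D * real_energy u)%:E)%E.
Proof.
have s1_gt0 : 0 < s1 by case/andP: s1_01.
have s2_gt0 : 0 < s2 by case/andP: s2_01.
have [C1 C10 C1P] := domain_coercive n_gt0 s1_gt0 oO1 oO2 bO1 bO2 O12.
have [C2 C20 C2P] := domain_coercive n_gt0 s2_gt0 oO2 oO1 bO2 bO1
  (etrans (setIC _ _) O12).
have d1 : 0 < C1 / a1 by exact: divr_gt0.
have d2 : 0 < C2 / a2 by exact: divr_gt0.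
exists (C1 / a1 + C2 / a2); first exact: addr_gt0.
move=> u Hu; have [h1 h2] := Hu.
have e1 := fine_ge0 (censored_ge0 O2 s1 u.1).
have e2 := fine_ge0 (censored_ge0 O1 s2 u.2).
have e3 := fine_ge0 (coupled_ge0 u).
have E0 : 0 <= real_energy u := quad_ge0 quadratic_real_energy Hu.
split.
- apply: (le_trans (C1P _ (Htilde_measurable h1) (Htilde_vanish mO1 h1))).
  rewrite -/(censored O2 s1 u.1) -[X in (_ * X)%E]fineK; last first.
    by rewrite ge0_fin_numE ?censored1_lty.
  rewrite -EFinM lee_fin; apply: (@le_trans _ _ (C1 / a1 * real_energy u)).
    rewrite -mulrA ler_pM2l// ler_pdivlMl// /real_energy -addrA lerDl.
    by rewrite addr_ge0// mulr_ge0 ?invr_ge0// ltW.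
  by rewrite ler_wpM2r// lerDl ltW.
- apply: (le_trans (C2P _ (Htilde_measurable h2) (Htilde_vanish mO2 h2))).
  rewrite -/(censored O1 s2 u.2) -[X in (_ * X)%E]fineK; last first.
    by rewrite ge0_fin_numE ?censored2_lty.
  rewrite -EFinM lee_fin; apply: (@le_trans _ _ (C2 / a2 * real_energy u)).
    rewrite -mulrA ler_pM2l// ler_pdivlMl// /real_energy addrAC lerDr.
    by rewrite addr_ge0// mulr_ge0 ?invr_ge0// ltW.
  by rewrite ler_wpM2r// lerDr ltW.
Qed.

Lemma energy_le_sobolev : exists2 B : R, 0 < B & forall u (e : R), H_pair u ->
  (sob s1 u.1 <= e%:E)%E -> (sob s2 u.2 <= e%:E)%E -> real_energy u <= B * e.
Proof.
have [C C0 CP] := coupled_le.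
exists (a1 + a2 + 2^-1 * (C * 2)); first by rewrite ltr_wpDr ?addr_gt0 ?mulr_ge0.
move=> u e Hu se1 se2; have [h1 h2] := Hu.
have f1e : fine (censored O2 s1 u.1) <= e.
  rewrite -lee_fin fineK ?ge0_fin_numE ?censored1_lty//.
  by apply: le_trans se1; apply: censored_le => //; exact: Htilde_measurable h1.
have f2e : fine (censored O1 s2 u.2) <= e.
  rewrite -lee_fin fineK ?ge0_fin_numE ?censored2_lty//.
  by apply: le_trans se2; apply: censored_le => //; exact: Htilde_measurable h2.
have f3e : fine (coupled u) <= C * 2 * e.
  rewrite -lee_fin fineK ?ge0_fin_numE ?coupled_lty//.
  apply: (le_trans (CP _ Hu)).
  rewrite -mulrA EFinM; apply: lee_wpmul2l; first by rewrite lee_fin.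
  by rewrite mulr_natl mulr2n EFinD; exact: leeD.
rewrite /real_energy.
have -> : (a1 + a2 + 2^-1 * (C * 2)) * e =
  a1 * e + a2 * e + 2^-1 * (C * 2 * e) by ring.
by apply: lerD; [apply: lerD|]; rewrite ler_pM2l// ?invr_gt0.
Qed.

Lemma complete_real_energy : complete_for H_pair real_energy.
Proof.
have [D D0 DP] := sobolev_le_energy; have [B B0 BP] := energy_le_sobolev.
have XB (u v : V) : H_pair u -> H_pair v -> H_pair (u - v).
  by move=> Xu Xv; have := subspace_H_pair.2 1 (-1) u v Xu Xv; rewrite scale1r scaleN1r.
move=> u Hu cu.
have m1 k : measurable_fun setT (u k).1.
  by have [h _] := Hu k; exact: Htilde_measurable h.
have m2 k : measurable_fun setT (u k).2.
  by have [_ h] := Hu k; exact: Htilde_measurable h.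
have [|v1 mv1 v1P] := @sobolev_complete _ _ _ mu (gker s1)
    (@measurable_gker R n s1) (@gker_ge0 R n s1) (fun k => (u k).1) m1.
  move=> e e0; have [N NP] := cu (e / D) (divr_gt0 e0 D0).
  exists N => j k Nj Nk; have [+ _] := DP _ (XB _ _ (Hu j) (Hu k)).
  move/le_trans; apply; rewrite lee_fin -ler_pdivlMl// mulrC.
  exact: NP.
have [|v2 mv2 v2P] := @sobolev_complete _ _ _ mu (gker s2)
    (@measurable_gker R n s2) (@gker_ge0 R n s2) (fun k => (u k).2) m2.
  move=> e e0; have [N NP] := cu (e / D) (divr_gt0 e0 D0).
  exists N => j k Nj Nk; have [_ +] := DP _ (XB _ _ (Hu j) (Hu k)).
  move/le_trans; apply; rewrite lee_fin -ler_pdivlMl// mulrC.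
  exact: NP.
have Hv1 : Htilde O1 s1 v1.
  apply: (Htilde_closed mv1) => e e0; have [N NP] := v1P e e0.
  by have [h _] := Hu N; exists (u N).1; [exact: h|exact: (NP N (leqnn N))].
have Hv2 : Htilde O2 s2 v2.
  apply: (Htilde_closed mv2) => e e0; have [N NP] := v2P e e0.
  by have [_ h] := Hu N; exists (u N).2; [exact: h|exact: (NP N (leqnn N))].
have Hv : H_pair (v1, v2) := conj Hv1 Hv2.
exists (v1, v2) => // e e0 N.
have [N1 N1P] := v1P (e / B) (divr_gt0 e0 B0).
have [N2 N2P] := v2P (e / B) (divr_gt0 e0 B0).
pose k := maxn N (maxn N1 N2).
have kN1 : (N1 <= k)%N by rewrite /k !leq_max leqnn orbT.
have kN2 : (N2 <= k)%N by rewrite /k !leq_max leqnn !orbT.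
exists k; first exact: leq_maxl.
apply: le_trans (BP _ (e / B) (XB _ _ (Hu k) Hv) _ _) _.
- exact: (N1P k kN1).
- exact: (N2P k kN2).
- by rewrite mulrCA divff ?mulr1// gt_eqF.
Qed.

Definition source u : R :=
  fine (\int[lebesgue_rV R n]_(x in O1) (f1 x * u.1 x)%:E)%E +
  fine (\int[lebesgue_rV R n]_(x in O2) (f2 x * u.2 x)%:E)%E.

Let source1_fin u : H_pair u ->
  (\int[lebesgue_rV R n]_(x in O1) (f1 x * u.1 x)%:E)%E \is a fin_num.
Proof.
move=> [h _]; apply: integrable_fin_num => //.
by apply: source_integrable => //; [exact: Htilde_measurable h|exact: L2_lty h].
Qed.

Let source2_fin u : H_pair u ->
  (\int[lebesgue_rV R n]_(x in O2) (f2 x * u.2 x)%:E)%E \is a fin_num.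
Proof.
move=> [_ h]; apply: integrable_fin_num => //.
by apply: source_integrable => //; [exact: Htilde_measurable h|exact: L2_lty h].
Qed.

Lemma total_energyE u : H_pair u ->
  total_energy O1 O2 J s1 s2 f1 f2 u.1 u.2 = (real_energy u - source u)%:E.
Proof.
move=> Hu; rewrite /total_energy energyE// /source opprD addrA !EFinB.
by rewrite !fineK ?source1_fin ?source2_fin.
Qed.

Let source_linear1 O f s (a b : R) v w : measurable O -> L2_on O f ->
  Htilde O s v -> Htilde O s w ->
  (\int[lebesgue_rV R n]_(x in O) (f x * (a * v x + b * w x))%:E =
   a%:E * \int[lebesgue_rV R n]_(x in O) (f x * v x)%:E +
   b%:E * \int[lebesgue_rV R n]_(x in O) (f x * w x)%:E)%E.
Proof.
move=> mO f_L2 hv hw.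
have iv := source_integrable mO f_L2 (Htilde_measurable hv) (L2_lty hv).
have iw := source_integrable mO f_L2 (Htilde_measurable hw) (L2_lty hw).
rewrite -!integralZl// -integralD//; try exact: integrableZl.
by apply: eq_integral => x _; rewrite -!EFinM -EFinD; congr EFin; ring.
Qed.

Lemma source_linear (a b : R) (u v : V) : H_pair u -> H_pair v ->
  source (a *: u + b *: v) = a * source u + b * source v.
Proof.
move=> Hu Hv; have [u1 u2] := Hu; have [v1 v2] := Hv.
rewrite /source (source_linear1 a b mO1 f1_L2 u1 v1) (source_linear1 a b mO2 f2_L2 u2 v2).
have fin (x y z t : \bar R) : x \is a fin_num -> y \is a fin_num ->
    z \is a fin_num -> t \is a fin_num ->
    fine (a%:E * x + b%:E * y) + fine (a%:E * z + b%:E * t) =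
    a * (fine x + fine z) + b * (fine y + fine t).
  by move: x y z t => [x||] [y||] [z||] [t||] //= _ _ _ _; ring.
by apply: fin; [exact: source1_fin|exact: source1_fin|exact: source2_fin|
  exact: source2_fin].
Qed.

(** The parameter e is chosen so that each source term costs at most half of
the energy. *)
Lemma total_energy_bounded_below : exists M, forall u, H_pair u ->
  M <= real_energy u - source u.
Proof.
have [D D0 DP] := sobolev_le_energy.
pose e := (2 * D)^-1.
have e0 : 0 < e by rewrite invr_gt0 mulr_gt0.
pose F1 := fine (\int[lebesgue_rV R n]_(x in O1) (f1 x ^+ 2)%:E)%E.
pose F2 := fine (\int[lebesgue_rV R n]_(x in O2) (f2 x ^+ 2)%:E)%E.
have half O f s v (E : R) : measurable O -> L2_on O f -> Htilde O s v ->
    (sob s v <= (D * E)%:E)%E ->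
    fine (\int[lebesgue_rV R n]_(x in O) (f x * v x)%:E)%E <=
    (4 * e)^-1 * fine (\int[lebesgue_rV R n]_(x in O) (f x ^+ 2)%:E)%E + 2^-1 * E.
  move=> mO f_L2 hv sE; have [mf ff] := f_L2.
  have iv := source_integrable mO f_L2 (Htilde_measurable hv) (L2_lty hv).
  rewrite -lee_fin fineK; last exact: integrable_fin_num.
  apply: (le_trans (source_le mO f_L2 e0 (Htilde_measurable hv) (L2_lty hv))).
  rewrite EFinD EFinM fineK; last first.
    by rewrite ge0_fin_numE//; apply: integral_ge0 => x _; rewrite lee_fin sqr_ge0.
  apply: leeD => //.
  rewrite (_ : 2^-1 * E = e * (D * E)); last by rewrite /e; field; rewrite gt_eqF.
  rewrite EFinM; apply: lee_wpmul2l; first by rewrite lee_fin ltW.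
  by apply: le_trans sE; rewrite L2_wsqE; exact: L2_le_sob.
exists (- ((4 * e)^-1 * F1 + (4 * e)^-1 * F2)) => u Hu.
have [h1 h2] := Hu; have [d1 d2] := DP _ Hu.
have := half _ _ _ _ _ mO1 f1_L2 h1 d1; have := half _ _ _ _ _ mO2 f2_L2 h2 d2.
rewrite /source -/F1 -/F2; move: (real_energy u) ((4 * e)^-1 * F1) ((4 * e)^-1 * F2).
move: (fine _) (fine _) => *; lra.
Qed.

Lemma real_energy0_ae u : H_pair u -> real_energy u = 0 ->
  ae_eq (lebesgue_rV R n) setT u.1 (cst 0) /\ ae_eq (lebesgue_rV R n) setT u.2 (cst 0).
Proof.
move=> Hu E0; have [D D0 DP] := sobolev_le_energy.
have [] := DP _ Hu; rewrite E0 mulr0 => d1 d2.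
have null s v : measurable_fun setT v -> (sob s v <= 0)%E ->
    ae_eq (lebesgue_rV R n) setT v (cst 0).
  move=> mv sv.
  have mv2 : measurable_fun setT (fun x => (v x ^+ 2)%:E).
    by apply/measurable_EFinP; exact: measurable_funX.
  have : (\int[lebesgue_rV R n]_x `|(v x ^+ 2)%:E|)%E = 0%E.
    apply/eqP; rewrite eq_le integral_ge0// andbT; apply: le_trans sv.
    apply: le_trans (L2_le_sob s v); rewrite -L2_wsqE.
    by under eq_integral do rewrite gee0_abs ?lee_fin ?sqr_ge0//.
  move=> /(ae_eq_integral_abs (lebesgue_rV R n) measurableT mv2); apply: filterS => x h _.
  by have := h I => -[] /eqP; rewrite sqrf_eq0 => /eqP.
have [h1 h2] := Hu; split.
  by apply: (null s1) => //; exact: Htilde_measurable h1.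
by apply: (null s2) => //; exact: Htilde_measurable h2.
Qed.

End nonlocal_energy.

Theorem theorem3p3 (R : realType) (n : nat) (O1 O2 : set 'rV[R]_n)
    (J : 'rV[R]_n -> R) (s1 s2 : R) (f1 f2 : 'rV[R]_n -> R)
    (n_ge2 : (2 <= n)%N)
    (O1_dom : lipschitz_domain O1) (O2_dom : lipschitz_domain O2)
    (O12_disj : closure O1 `&` closure O2 = set0)
    (J_meas : measurable_fun setT J)
    (J_ge0 : {ae lebesgue_rV R n, forall z, 0 <= J z})
    (J_sym : {ae lebesgue_rV R n, forall z, J z = J (- z)})
    (J_L1 : (lebesgue_rV R n).-integrable setT (EFin \o J))
    (J_supp : exists2 r, set_dist O1 O2 < r & eball 0 r `<=` ess_support J)
    (s1_01 : 0 < s1 < 1) (s2_01 : 0 < s2 < 1)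
    (f1_L2 : L2_on O1 f1) (f2_L2 : L2_on O2 f2) :
  (forall u u1 u2, H_decomposition O1 O2 s1 s2 u u1 u2 ->
     total_energy O1 O2 J s1 s2 f1 f2 u1 u2 \is a fin_num) /\
  exists u, H_minimizer O1 O2 J s1 s2 f1 f2 u /\
    forall v, H_minimizer O1 O2 J s1 s2 f1 f2 v ->
      ae_eq (lebesgue_rV R n) setT v u.
Proof.
have [_ oO1 _ bO1 _] := O1_dom; have [_ oO2 _ bO2 _] := O2_dom.
have n_gt0 : (0 < n)%N by exact: leq_trans n_ge2.
pose X := H_pair O1 O2 s1 s2.
pose A := real_energy O1 O2 J s1 s2 (frac_coef n s1 / 2) (frac_coef n s2 / 2).
pose l := source O1 O2 f1 f2.
have totE w : X w ->
    total_energy O1 O2 J s1 s2 f1 f2 w.1 w.2 = (A w - l w)%:E.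
  by move=> Xw; exact: total_energyE.
have XH u u1 u2 : H_decomposition O1 O2 s1 s2 u u1 u2 -> X (u1, u2).
  by move=> [h1 h2 _]; exact: (conj h1 h2).
have HX w1 w2 : X (w1, w2) -> H_decomposition O1 O2 s1 s2 (w1 \+ w2) w1 w2.
  by move=> [h1 h2]; exact: (And3 h1 h2 erefl).
split; first by move=> u u1 u2 /XH Xu; rewrite (totE _ Xu).
have subX : subspace_set X := subspace_H_pair O1 O2 s1 s2.
have quadA : quadratic_on X A by exact: quadratic_real_energy.
have linl (a b : R) u v : X u -> X v -> l (a *: u + b *: v) = a * l u + b * l v.
  exact: source_linear.
have [M MP] : exists M, forall u, X u -> M <= A u - l u.
  exact: total_energy_bounded_below.
have cA : complete_for X A by exact: complete_real_energy.
have minP v v1 v2 : H_decomposition O1 O2 s1 s2 v v1 v2 ->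
    (forall w w1 w2, H_decomposition O1 O2 s1 s2 w w1 w2 ->
      (total_energy O1 O2 J s1 s2 f1 f2 v1 v2 <=
       total_energy O1 O2 J s1 s2 f1 f2 w1 w2)%E) <->
    forall w, X w -> A (v1, v2) - l (v1, v2) <= A w - l w.
  move=> /XH Xv; split => h.
    move=> [w1 w2] Xw; rewrite -lee_fin -(totE _ Xv) -(totE _ Xw).
    exact: (h _ _ _ (HX _ _ Xw)).
  by move=> w w1 w2 /XH Xw; rewrite (totE _ Xv) (totE _ Xw) lee_fin; exact: h.
have [[u1 u2] Xu umin] := minimizer_exists subX quadA linl MP cA.
have Hu := HX _ _ Xu.
exists (u1 \+ u2); split.
  by exists u1, u2; split => //; exact: (minP _ _ _ Hu).2.
move=> v [v1 [v2 [Hv vmin]]]; have Xv := XH _ _ _ Hv.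
have A0 := minimizer_unique subX quadA linl Xv Xu ((minP _ _ _ Hv).1 vmin) umin.
have Xd : X ((v1, v2) - (u1, u2)).
  by have := subX.2 1 (-1) _ _ Xv Xu; rewrite scale1r scaleN1r.
have [e1 e2] := real_energy0_ae n_gt0 oO1 oO2 bO1 bO2 O12_disj J_meas J_L1
  s1_01 s2_01 erefl erefl Xd A0.
have [_ _ ->] := Hv.
apply: filterS2 e1 e2 => x /(_ I) /= e1 /(_ I) /= e2 _ /=.
by congr (_ + _); apply/subr0_eq.
Qed.
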